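(* Let $H$ be an infinite dimensional Hilbert space. Then there exist five closed subspaces of $H$ such that for every $0\neq z\in H$ some sequence of iterates of $z$ defined by the orthogonal projections onto those subspaces does not converge in norm. More precisely, there exists a sequence $k_1,k_2,\dots\in\{1,2,3\}$ with the following property. Every infinite dimensional Hilbert space $H$ has closed subspaces $X,Y,X_1,X_2,X_3$ such that if $0\neq z\in H$, and $u_0=Xz$, $v_0=XYz$, then at least one of the sequences of iterates $\{u_n\}_{n=1}^{\infty}$ or $\{v_n\}_{n=1}^{\infty}$ defined by $u_n=X_{k_n}u_{n-1}$, $v_n=X_{k_n}v_{n-1}$ for $n\ge 1$ does not converge in norm.
   Context: For a closed subspace $X$ of a Hilbert space $H$, the same symbol $X$ also denotes the orthogonal projection of $H$ onto $X$; products such as $XYz$ mean composition of these orthogonal projections applied to $z$ (first $Y$, then $X$). A sequence of iterates of $z$ defined by the orthogonal projections onto closed subspaces $M_1,\dots,M_K$ is a sequence $\{z_n\}_{n\ge1}$ with $z_0=z$ and $z_n=M_{j_n}z_{n-1}$ for some indices $j_1,j_2,\dots\in\{1,\dots,K\}$. *)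

(* Defs.v *)
From HB Require Import structures.
From mathcomp Require Import all_boot all_order all_algebra sesquilinear.
From mathcomp Require Import complex.
From mathcomp Require Import all_classical all_reals all_analysis.

Set Implicit Arguments.
Unset Strict Implicit.
Unset Printing Implicit Defensive.

Import Order.TTheory GRing.Theory Num.Theory.
Import numFieldNormedType.Exports.

Local Open Scope classical_set_scope.
Local Open Scope ring_scope.

(* Hilbert spaces are taken over the reals or over the complex numbers. *)
Variant scalars := RealScalars | ComplexScalars.

Definition scalar_field (R : realType) (F : scalars) : numFieldType :=
  match F with RealScalars => R | ComplexScalars => R[i] end.

Definition scalar_conj (R : realType) (F : scalars) :
    scalar_field R F -> scalar_field R F :=
  match F return scalar_field R F -> scalar_field R F with
  | RealScalars => idfun
  | ComplexScalars => @conjc R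
  end.
Arguments scalar_conj : clear implicits.

Record hilbertSpace (R : realType) (F : scalars) := HilbertSpace {
  hilbert_sort :> completeNormedModType (scalar_field R F);
  dotp : {dot hilbert_sort for scalar_conj R F};
  dotp_norm : forall x : hilbert_sort, dotp x x = `|x| ^+ 2 }.
Arguments dotp {R F} h.

Section Definitions.
Context {R : realType} {F : scalars}.
Implicit Type H : hilbertSpace R F.

Definition infinite_dimensional H : Prop :=
  ~ exists n (e : 'I_n -> H), forall x : H,
      exists c : 'I_n -> scalar_field R F, x = \sum_(i < n) c i *: e i.

Definition closed_subspace H (M : set H) : Prop :=
  [/\ M 0,
      forall (a : scalar_field R F) (x y : H), M x -> M y -> M (a *: x + y)
    & closed M].

(* The point p of M with z - p orthogonal to M: it is unique, and it exists
   when M is a closed subspace; the default value 0 is then irrelevant. *)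
Definition orthoproj H (M : set H) (z : H) : H :=
  xget 0 [set p : H | M p /\ forall y : H, M y -> dotp H (z - p) y = 0].

(* Indices are shifted by one: the (n+1)-st projection is onto M (j n). *)
Fixpoint iterates H (K : nat) (M : 'I_K -> set H) (j : nat -> 'I_K)
    (z : H) (n : nat) : H :=
  if n is m.+1 then orthoproj (M (j m)) (iterates M j z m) else z.

End Definitions.

(* Main.v *)
Require Import Defs.
From HB Require Import structures.
From mathcomp Require Import all_boot all_order all_algebra sesquilinear.
From mathcomp Require Import complex ring lra zify.
From mathcomp Require Import all_classical all_reals all_analysis.

Set Implicit Arguments.
Unset Strict Implicit.
Unset Printing Implicit Defensive.

Import Order.TTheory GRing.Theory Num.Theory.
Import numFieldNormedType.Exports.

Local Open Scope classical_set_scope.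
Local Open Scope ring_scope.

(** Consecutive vectors of an orthonormal sequence e_0, e_1, e_2, ... can be
joined by projections almost without loss of length: in the plane of e_m and
e_(m+1) draw K spokes at angle pi/(2K) from each other and project e_m onto
them one after the other; the result is cos(pi/(2K))^K e_(m+1), close to e_(m+1)
for large K (quarter_turn). If each projection onto a spoke is approximated by a
word in three fixed projections, with errors that are summable over all spokes
of all planes, then the iterates of e_0 pass close to e_0, e_1, e_2, ..., and
cannot converge in norm (iterates_diverge).

Three projections P, Q, Z are as good as two positive contractions A = PQP
and B = PZP of the range of P, with words in powers of A and B. Indeed the
damping by 1 - kappa along a unit vector g of the range of P is the compression
to that range of the projection orthogonal to sqrt(kappa) g - sqrt(1-kappa) h,
where h is orthogonal to that range. The block m is a space that contains e_m,
e_(m+1) and auxiliary coordinates, in which orthonormal vectors g_i are damped by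
factors 1 - kappa_i: by A if m is even, by B if m is odd. The contraction of the
other parity kills the auxiliary coordinates of the block, and it hardly moves
e_m and e_(m+1), because the blocks m-1 and m+1 are damped slowly. Blocks of equal
parity are orthogonal. During the turn from e_m to e_(m+1), for m even, B A^s thus
acts on the plane of e_m and e_(m+1) almost as
  x |-> x - sum_i Delta_i (1 - (1 - kappa_i)^s) (x . n_i) n_i,
where sqrt(Delta_i) n_i is the component of g_i in the plane
(compress_compression); orthonormal vectors g_i with prescribed components
exist by an explicit dilation (dilation_coisometry). Here n_i is the unit
normal of the i-th spoke. The weights Delta_i increase with i and the rates
kappa_i decrease still faster, both geometrically. For s = 1/kappa_t the
direction n_t therefore outweighs all the others, as the later directions have
hardly been damped and the earlier ones have small weights (removed_diag,
removed_offdiag). Iterating B A^s destroys the component along n_t before the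
others are affected, which approximates the projection onto the spoke t
(block_rotation).

This construction depends on integer parameters only, so one infinite word serves
all Hilbert spaces, and it can be carried out at once in all copies of a
decomposition of H into an orthogonal sum of copies of l2
(orthonormal_system). Let X be spanned by the first vectors of the copies. A
nonzero vector of X has a nonzero component in some copy, where its iterates
diverge. Finally Y is chosen such that each of its points has, among its
coordinates along X, a copy of all its other coordinates; a vector annihilated
both by X and by XY is then zero (head_or_graph). *)

(** * Real and complex scalars *)

Section Scalars.
Context {R : realType} {F : scalars}.
Local Notation C := (scalar_field R F).

(** The real numbers inside the field of scalars, and the real part. All estimates
    take place in the real Hilbert space that underlies H, which treats both
    fields of scalars at once. *)
Definition emb : R -> C :=
  match F return R -> scalar_field R F with
  | RealScalars => idfun
  | ComplexScalars => real_complex R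
  end.

Definition re : C -> R :=
  match F return scalar_field R F -> R with
  | RealScalars => idfun
  | ComplexScalars => @complex.Re R
  end.

Fact emb_zmod_morphism : zmod_morphism emb.
Proof. by rewrite /emb; case: F => // x y /=; rewrite rmorphB. Qed.
Fact emb_monoid_morphism : monoid_morphism emb.
Proof.
rewrite /emb; case: F => //=; split; first exact: rmorph1.
exact: rmorphM.
Qed.
HB.instance Definition _ := GRing.isZmodMorphism.Build R C emb emb_zmod_morphism.
HB.instance Definition _ := GRing.isMonoidMorphism.Build R C emb emb_monoid_morphism.

Fact re_zmod_morphism : zmod_morphism re.
Proof. by rewrite /re; case: F => // [[a b] [c d]]. Qed.
HB.instance Definition _ := GRing.isZmodMorphism.Build C R re re_zmod_morphism.

Lemma embK r : re (emb r) = r.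
Proof. by rewrite /re /emb; case: F. Qed.

Lemma re_embM r z : re (emb r * z) = r * re z.
Proof.
by move: z; rewrite /re /emb; case: F => // -[a b] /=; rewrite mul0r subr0.
Qed.

Lemma re_conj z : re (scalar_conj R F z) = re z.
Proof. by move: z; rewrite /re /scalar_conj; case: F => // -[]. Qed.

Lemma conj_emb r : scalar_conj R F (emb r) = emb r.
Proof. by rewrite /emb /scalar_conj; case: F => //=; rewrite oppr0. Qed.

Lemma conj0 : scalar_conj R F 0 = 0.
Proof. by rewrite -(rmorph0 emb) conj_emb. Qed.

Lemma emb_re z : 0 <= z -> emb (re z) = z.
Proof.
move: z; rewrite /re /emb; case: F => // -[a b] /=.
by rewrite lecE /= => /andP[/eqP ->].
Qed.

Lemma ler_emb a b : (emb a <= emb b) = (a <= b).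
Proof. by rewrite /emb; case: F => /=; rewrite ?lecR. Qed.

Lemma ltr_emb a b : (emb a < emb b) = (a < b).
Proof. by rewrite !lt_def ler_emb (inj_eq (can_inj embK)). Qed.

Lemma emb_norm r : emb `|r| = `|emb r|.
Proof.
have e0 : (emb 0 : C) = 0 by exact: rmorph0.
have [r0|r0] := ger0P r; first by rewrite ger0_norm// -e0 ler_emb.
by rewrite rmorphN ltr0_norm// -e0 ltr_emb.
Qed.

Lemma re_ge0 z : 0 <= z -> 0 <= re z.
Proof. by move=> z0; rewrite -ler_emb rmorph0 emb_re. Qed.

Lemma re_mulconj_ge0 z : 0 <= re (z * scalar_conj R F z).
Proof.
move: z; rewrite /re /scalar_conj; case: F => [z|[a b]] /=; first exact: sqr_ge0.
by rewrite mulrN opprK -!expr2 addr_ge0// sqr_ge0.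
Qed.

Lemma re_mulconj_eq0 z : re (z * scalar_conj R F z) = 0 -> z = 0.
Proof.
move: z; rewrite /re /scalar_conj; case: F => [z|[a b]] /=.
  by move/eqP; rewrite mulf_eq0 orbb => /eqP.
rewrite mulrN opprK -!expr2 => /eqP; rewrite paddr_eq0 ?sqr_ge0 //.
by rewrite !sqrf_eq0 => /andP[/eqP-> /eqP->].
Qed.

Lemma emb_re_mulconj z : emb (re (z * scalar_conj R F z)) = z * scalar_conj R F z.
Proof.
move: z; rewrite /emb /re /scalar_conj; case: F => [z|[a b]] //=.
by rewrite /real_complex_def; congr (_ +i* _)%C; rewrite mulrN mulrC addNr.
Qed.

End Scalars.

Local Notation "r *:: x" := (emb r *: x) (at level 40).

(** * The underlying real Hilbert space *)

Section RealStructure.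
Context {R : realType} {F : scalars} {H : hilbertSpace R F}.
Local Notation C := (scalar_field R F).
Implicit Types (x y z : H) (r : R).

Lemma dotpC x y : dotp H x y = scalar_conj R F (dotp H y x).
Proof. by rewrite (hermitian_subproof (s := dotp H)) expr0 mul1r. Qed.
Lemma dotpDl x y z : dotp H (x + y) z = dotp H x z + dotp H y z.
Proof. exact: linearDl. Qed.
Lemma dotpBl x y z : dotp H (x - y) z = dotp H x z - dotp H y z.
Proof. exact: linearBl. Qed.
Lemma dotpDr x y z : dotp H z (x + y) = dotp H z x + dotp H z y.
Proof. exact: linearDr. Qed.
Lemma dotpBr x y z : dotp H z (x - y) = dotp H z x - dotp H z y.
Proof. exact: linearBr. Qed.
Lemma dotp0l z : dotp H 0 z = 0.
Proof. exact: linear0l. Qed.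

Lemma dotpZl (a : C) x y : dotp H (a *: x) y = a * dotp H x y.
Proof. exact: linearZl_LR. Qed.
Lemma dotpZr (a : C) x y : dotp H x (a *: y) = scalar_conj R F a * dotp H x y.
Proof. exact: linearZr_LR. Qed.
Lemma dotp_suml I (s : seq I) (P : pred I) (f : I -> H) y :
  dotp H (\sum_(i <- s | P i) f i) y = \sum_(i <- s | P i) dotp H (f i) y.
Proof. exact: linear_sumlz. Qed.
Lemma dotp_sumr I (s : seq I) (P : pred I) (f : I -> H) y :
  dotp H y (\sum_(i <- s | P i) f i) = \sum_(i <- s | P i) dotp H y (f i).
Proof. exact: linear_sumr. Qed.

Definition rdot x y : R := re (dotp H x y).
Definition rnorm x : R := re `|x|.

Lemma rdotC x y : rdot x y = rdot y x.
Proof. by rewrite /rdot dotpC re_conj. Qed.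
Lemma rdotDl x y z : rdot (x + y) z = rdot x z + rdot y z.
Proof. by rewrite /rdot dotpDl raddfD. Qed.
Lemma rdotBl x y z : rdot (x - y) z = rdot x z - rdot y z.
Proof. by rewrite /rdot dotpBl raddfB. Qed.
Lemma rdotDr x y z : rdot z (x + y) = rdot z x + rdot z y.
Proof. by rewrite /rdot dotpDr raddfD. Qed.
Lemma rdotBr x y z : rdot z (x - y) = rdot z x - rdot z y.
Proof. by rewrite /rdot dotpBr raddfB. Qed.
Lemma rdot0l z : rdot 0 z = 0.
Proof. by rewrite /rdot dotp0l raddf0. Qed.
Lemma rdotZl r x y : rdot (emb r *: x) y = r * rdot x y.
Proof. by rewrite /rdot dotpZl re_embM. Qed.
Lemma rdotZr r x y : rdot x (emb r *: y) = r * rdot x y.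
Proof. by rewrite rdotC rdotZl rdotC. Qed.

Lemma emb_rnorm x : emb (rnorm x) = `|x|.
Proof. exact: emb_re. Qed.
Lemma rnorm_ge0 x : 0 <= rnorm x.
Proof. exact: re_ge0. Qed.
Lemma rnorm0 : rnorm 0 = 0.
Proof. by rewrite /rnorm normr0 raddf0. Qed.
Lemma rnorm_sqr x : rnorm x ^+ 2 = rdot x x.
Proof. by rewrite /rdot dotp_norm -emb_rnorm -rmorphXn embK. Qed.
Lemma rnormD x y : rnorm (x + y) <= rnorm x + rnorm y.
Proof. by rewrite -(@ler_emb R F) rmorphD /= !emb_rnorm ler_normD. Qed.
Lemma rnormB x y : rnorm (x - y) = rnorm (y - x).
Proof. by rewrite /rnorm distrC. Qed.
Lemma rnormN x : rnorm (- x) = rnorm x.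
Proof. by rewrite /rnorm normrN. Qed.
Lemma rnormZ r x : rnorm (emb r *: x) = `|r| * rnorm x.
Proof. by rewrite /rnorm normrZ -emb_norm re_embM. Qed.
Lemma rnorm_eq0 x : rnorm x = 0 -> x = 0.
Proof. by move=> x0; apply/eqP; rewrite -normr_eq0 -emb_rnorm x0 rmorph0. Qed.
Lemma rnorm_sum I (s : seq I) (P : pred I) (f : I -> H) :
  rnorm (\sum_(i <- s | P i) f i) <= \sum_(i <- s | P i) rnorm (f i).
Proof.
elim/big_rec2: _ => [|i y x _ le_xy]; first by rewrite rnorm0.
by rewrite (le_trans (rnormD _ _))// lerD2l.
Qed.

(** Cauchy-Schwarz: expand the square of |y|^2 x - (x . y) y. *)
Lemma rdot_le x y : rdot x y <= rnorm x * rnorm y.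
Proof.
have [y0|y0] := eqVneq (rnorm y) 0.
  by rewrite (rnorm_eq0 y0) rdotC rdot0l rnorm0 mulr0.
have y_gt0 : 0 < rnorm y by rewrite lt_def y0 rnorm_ge0.
rewrite (le_trans (ler_norm _))// -ler_sqr ?nnegrE ?mulr_ge0 ?rnorm_ge0//.
rewrite exprMn -normrX ger0_norm ?sqr_ge0//.
rewrite -(ler_pM2r (exprn_gt0 2 y_gt0)) -subr_ge0.
set a := rnorm y ^+ 2; set b := rdot x y.
have := sqr_ge0 (rnorm (emb a *: x - emb b *: y)).
rewrite rnorm_sqr rdotBl !rdotBr !rdotZl !rdotZr -!rnorm_sqr (rdotC y x).
by rewrite -/a -/b; congr (_ <= _); ring.
Qed.

End RealStructure.

(** * Orthogonal projections onto closed subspaces *)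

Section Projection.
Context {R : realType} {F : scalars} {H : hilbertSpace R F}.
Local Notation C := (scalar_field R F).
Implicit Types (x y z : H) (M : set H).

Lemma rcvgP (u : nat -> H) p : u @ \oo --> p <->
  forall e : R, 0 < e -> exists N, forall n, (N <= n)%N -> rnorm (u n - p) < e.
Proof.
split=> [/cvgrPdist_lt up e e0|up].
  have : (0 : C) < emb e by rewrite -(rmorph0 (@emb R F)) ltr_emb.
  move=> /up [N _ uN]; exists N => n /uN /=.
  by rewrite -emb_rnorm ltr_emb rnormB.
apply/cvgrPdist_lt => e e0.
have eE : emb (re e) = e by rewrite emb_re// ltW.
have : 0 < re e by rewrite -(@ltr_emb R F) rmorph0 eE.
move=> /up [N uN]; exists N => // n /= /uN.
by rewrite -(@ltr_emb R F) eE emb_rnorm distrC.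
Qed.

Lemma rcauchy_cvg (u : nat -> H) :
  (forall e : R, 0 < e -> exists N, forall n m, (N <= n)%N -> (N <= m)%N ->
     rnorm (u n - u m) < e) -> exists p : H, u @ \oo --> p.
Proof.
move=> ucauchy; apply/cvg_ex/cauchy_cvgP/cauchy_ballP => e e0.
have eE : emb (re e) = e by rewrite emb_re// ltW.
have : 0 < re e by rewrite -(@ltr_emb R F) rmorph0 eE.
move=> /ucauchy [N uN].
exists (u @` [set n | (N <= n)%N], u @` [set n | (N <= n)%N]) => /=.
  by split; exists N => // n /= Nn; exists n.
move=> [_ _] /= [[n Nn <-] [m Nm <-]].
by rewrite -ball_normE /ball_ /= -emb_rnorm -eE ltr_emb; exact: uN.
Qed.

Lemma closed_subspaceB M x y : closed_subspace M -> M x -> M y -> M (x - y).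
Proof.
by move=> [_ ML _] Mx My; have := ML (-1) y x My Mx; rewrite scaleN1r addrC.
Qed.

Lemma closed_subspaceZ M a x : closed_subspace M -> M x -> M (a *: x).
Proof. by move=> [M0 ML _] Mx; have := ML a x 0 Mx M0; rewrite addr0. Qed.

Lemma closed_subspaceD M x y : closed_subspace M -> M x -> M y -> M (x + y).
Proof. by move=> [M0 ML _] Mx My; have := ML 1 x y Mx My; rewrite scale1r. Qed.

Lemma parallelogram x y :
  rnorm (x + y) ^+ 2 + rnorm (x - y) ^+ 2 = 2 * rnorm x ^+ 2 + 2 * rnorm y ^+ 2.
Proof.
rewrite !rnorm_sqr !(rdotBl, rdotDl) !(rdotBr, rdotDr) (rdotC y x).
by ring.
Qed.

(** A sequence of points y_n of M whose distances to z tend to the infimum is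
    Cauchy, by the parallelogram identity. Its limit p minimizes the
    distance, so moving p by t w within M gains nothing: 2 t (z - p . w) is at
    most of the order of t^2 for all t > 0, and (z - p . w) <= 0. *)
Lemma projection_theorem M z : closed_subspace M ->
  exists p, M p /\ forall y, M y -> dotp H (z - p) y = 0.
Proof.
move=> cM; have [M0 ML Mc] := cM.
pose S := [set rnorm (z - y) ^+ 2 | y in M].
have S0 : nonempty S by exists (rnorm (z - 0) ^+ 2); exists 0.
have Slb : has_lbound S by exists 0 => _ [y _ <-]; exact: sqr_ge0.
have /choice [y yP] : forall n : nat, exists y, M y /\
    rnorm (z - y) ^+ 2 < inf S + n.+1%:R^-1.
  move=> n; have e0 : (0 : R) < n.+1%:R^-1 by rewrite invr_gt0.
  by have [_ [y My <-] yS] := inf_adherent e0 (conj S0 Slb); exists y.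
have leS w : M w -> inf S <= rnorm (z - w) ^+ 2.
  by move=> Mw; apply: ge_inf => //; exists w.
have inv_small (e : R) : 0 < e -> exists N, forall n, (N <= n)%N ->
    n.+1%:R^-1 < e.
  move=> e0; exists (Num.truncn e^-1) => n Nn.
  rewrite invf_plt ?posrE//; apply: lt_le_trans (truncnS_gt _) _.
  by rewrite ler_nat.
have dist_y n m : rnorm (y n - y m) ^+ 2 <= 2 * n.+1%:R^-1 + 2 * m.+1%:R^-1.
  have := parallelogram (z - y n) (z - y m).
  pose w := (2^-1 : C) *: (y n + y m).
  have -> : z - y n - (z - y m) = y m - y n.
    by rewrite opprB addrC addrA subrK.
  have -> : z - y n + (z - y m) = emb 2 *: (z - w).
    rewrite rmorph_nat scalerBr scalerA mulfV ?pnatr_eq0// scale1r scaler_nat.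
    by rewrite mulr2n addrACA opprD.
  have Mw : M w.
    by apply: closed_subspaceZ => //; apply: closed_subspaceD => //;
      case: (yP n); case: (yP m).
  rewrite rnormZ ger0_norm// exprMn [rnorm (y m - y n)]rnormB.
  move: (leS _ Mw) (yP n).2 (yP m).2.
  by set a := n.+1%:R^-1; set b := m.+1%:R^-1; lra.
have [|p yp] := @rcauchy_cvg y.
  move=> e e0.
  have [N yN] := inv_small (e ^+ 2 / 4) ltac:(by rewrite divr_gt0 ?exprn_gt0).
  exists N => n m /yN Nn /yN Nm; rewrite -ltr_sqr ?nnegrE ?rnorm_ge0 ?ltW//.
  have := dist_y n m; move: Nn Nm.
  by set a := n.+1%:R^-1; set b := m.+1%:R^-1; lra.
have Mp : M p.
  by apply: (closed_cvg _ Mc _ _ yp); near=> n; case: (yP n).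
have small w (t : R) : M w -> 0 < t -> rdot (z - p) w <= t * (1 + rnorm w) ^+ 2.
  move=> Mw t0.
  have [N1 yN1] := inv_small (t ^+ 2) ltac:(by rewrite exprn_gt0).
  have [N2 yN2] := (rcvgP _ _).1 yp t t0.
  pose n := maxn N1 N2.
  have := yN1 n (leq_maxl _ _); have := yN2 n (leq_maxr _ _).
  case: (yP n) => Myn yn d1 d2.
  have Mv : M (y n + emb t *: w).
    by apply: closed_subspaceD => //; exact: closed_subspaceZ.
  have := leS _ Mv; rewrite opprD addrA.
  have -> : z - p = (z - y n) + (y n - p) by rewrite addrA subrK.
  move: (z - y n) yn => v yn.
  rewrite rnorm_sqr rdotBl !rdotBr !rdotZl !rdotZr -!rnorm_sqr (rdotC w) rdotDl.
  have w0 := rnorm_ge0 w; have := rdot_le (y n - p) w.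
  have := ler_wpM2r w0 (ltW d1); move: yn d2.
  set a := n.+1%:R^-1; set b := rdot v w; set c := rdot _ w.
  set d := rnorm v ^+ 2; set wn := rnorm w in w0 *.
  set f := rnorm _ * wn => yn at2 fw cf dd.
  have tc : t * c <= t * (t * wn) by rewrite ler_pM2l// (le_trans cf).
  have t2 := sqr_ge0 t; have tw := mulr_ge0 t2 w0.
  have tww := mulr_ge0 t2 (sqr_ge0 wn).
  rewrite -(ler_pM2l t0); move: tc t2 tw tww dd yn at2 => {fw cf}.
  clearbody a b c d wn; nra.
have nonpos w : M w -> rdot (z - p) w <= 0.
  move=> Mw; apply/ler_addgt0Pr => e e0; rewrite add0r.
  have w1 : 0 < (1 + rnorm w) ^+ 2.
    by rewrite exprn_gt0// (lt_le_trans ltr01)// lerDl rnorm_ge0.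
  have := small w _ Mw (divr_gt0 e0 w1).
  by rewrite divfK// gt_eqF.
exists p; split => // w Mw.
apply: re_mulconj_eq0; apply/eqP; rewrite eq_le re_mulconj_ge0 andbT.
(* w may be replaced by any scalar multiple, here by (z - p . w) w *)
have := nonpos _ (closed_subspaceZ (dotp H (z - p) w) cM Mw).
by rewrite /rdot dotpZr mulrC.
Unshelve. all: by end_near. Qed.

Section Orthoproj.
Variables (M : set H) (cM : closed_subspace M).

Lemma orthoprojP z :
  M (orthoproj M z) /\ forall y, M y -> dotp H (z - orthoproj M z) y = 0.
Proof. by rewrite /orthoproj; case: xgetP => [p ->//|no]; have [p /no] := projection_theorem z cM. Qed.

Lemma orthoproj_eq z p :
  M p -> (forall y, M y -> dotp H (z - p) y = 0) -> orthoproj M z = p.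
Proof.
move=> Mp zp; have [Mq zq] := orthoprojP z.
have Md : M (p - orthoproj M z) by exact: closed_subspaceB.
apply/eqP; rewrite eq_sym -subr_eq0; apply/eqP/rnorm_eq0/eqP.
have dE : p - orthoproj M z = (z - orthoproj M z) - (z - p).
  by rewrite [z - _]addrC opprB -addrA subrKC addrC.
by rewrite -sqrf_eq0 rnorm_sqr /rdot {1}dE dotpBl zp// zq// subrr raddf0.
Qed.

Lemma orthoproj_id z : M z -> orthoproj M z = z.
Proof. by move=> Mz; apply: orthoproj_eq => // y _; rewrite subrr dotp0l. Qed.

Lemma orthoproj_linear : linear (orthoproj M).
Proof.
move=> a x y; have [Mx xP] := orthoprojP x; have [My yP] := orthoprojP y.
apply: orthoproj_eq => [|w Mw].
  by apply: closed_subspaceD => //; exact: closed_subspaceZ.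
by rewrite opprD addrACA -scalerBr dotpDl dotpZl xP// yP// mulr0 addr0.
Qed.

Lemma orthoproj0 : orthoproj M 0 = 0.
Proof. by apply: orthoproj_id; case: cM. Qed.

Lemma orthoprojZ a x : orthoproj M (a *: x) = a *: orthoproj M x.
Proof. by rewrite -[a *: x]addr0 orthoproj_linear orthoproj0 addr0. Qed.

Lemma orthoprojB : {morph orthoproj M : x y / x - y}.
Proof. by move=> x y; rewrite addrC -scaleN1r orthoproj_linear scaleN1r addrC. Qed.

Lemma orthoproj_sum I (r : seq I) (P : pred I) (f : I -> H) :
  orthoproj M (\sum_(i <- r | P i) f i) = \sum_(i <- r | P i) orthoproj M (f i).
Proof.
apply: (big_morph _ _ orthoproj0) => x y.
by rewrite -[x]scale1r orthoproj_linear !scale1r.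
Qed.

Lemma orthoproj_contraction x : rnorm (orthoproj M x) <= rnorm x.
Proof.
have [Mp xP] := orthoprojP x.
rewrite -ler_sqr ?nnegrE ?rnorm_ge0// !rnorm_sqr.
have xp : rdot (x - orthoproj M x) (orthoproj M x) = 0 by rewrite /rdot xP ?raddf0.
have xE := subrK (orthoproj M x) x.
move: (x - orthoproj M x) xE xp => v vE vp; rewrite -[in leRHS]vE.
rewrite rdotDl !rdotDr (rdotC _ v) vp addr0 add0r lerDr.
by rewrite -rnorm_sqr sqr_ge0.
Qed.


End Orthoproj.
End Projection.

(** * Turning a vector by projections onto spokes *)

Section RealEstimates.
Context {R : realType}.
Implicit Types (x a : R) (n : nat).

Lemma sin_le x : 0 <= x -> sin x <= x.
Proof.
move=> x0; have [|c _] := @MVT_segment R sin cos 0 x x0 (fun c _ => is_derive_sin c).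
  by apply: continuous_subspaceT; exact: continuous_sin.
rewrite sin0 !subr0 => ->; rewrite -[leRHS]mul1r ler_wpM2r// cos_le1.
Qed.

Lemma cos_ge x : 0 <= x <= 2 -> 1 - cos x <= x ^+ 2 / 2.
Proof.
move=> /andP[x0 x2].
have h0 : 0 <= x / 2 by rewrite divr_ge0.
have -> : 1 - cos x = 2 * sin (x / 2) ^+ 2.
  have -> : cos x = cos ((x / 2) *+ 2) by congr cos; rewrite -mulr_natr; field.
  by rewrite sin2cos2 cos_mulr2n; ring.
have s0 : 0 <= sin (x / 2).
  apply: sin_ge0_pi; rewrite h0 /= (le_trans _ (pi_ge2 R))//.
  by rewrite ler_pdivrMr//; lra.
have := sin_le h0 => sl.
have : sin (x / 2) ^+ 2 <= (x / 2) ^+ 2 by rewrite ler_sqr.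
by lra.
Qed.

Lemma expr_ge_bernoulli a n : 0 <= a <= 1 -> 1 - a ^+ n <= n%:R * (1 - a).
Proof.
move=> /andP[a0 a1]; elim: n => [|n IH]; first by rewrite expr0 subrr mul0r.
rewrite exprS -natr1 mulrDl mul1r.
have : a ^+ n <= 1 by rewrite exprn_ile1.
by have := ler_wpM2l a0 IH; have := exprn_ge0 n a0; nra.
Qed.

(** Bernoulli's inequality for (1 + a)^n, multiplied by (1 - a)^n and
    (1 - a)(1 + a) <= 1. *)
Lemma expr_le_inv a n : 0 <= a <= 1 -> (1 - a) ^+ n * (1 + n%:R * a) <= 1.
Proof.
move=> /andP[a0 a1]; elim: n => [|n IH]; first by rewrite expr0 mul0r addr0 mulr1.
rewrite exprS -natr1; apply: le_trans IH.
have : 0 <= (1 - a) ^+ n by rewrite exprn_ge0// subr_ge0.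
have na : 0 <= n%:R * a by rewrite mulr_ge0.
move: (_ ^+ n) => c c0.
rewrite mulrAC -subr_ge0.
have -> : c * (1 + n%:R * a) - (1 - a) * (1 + (n%:R + 1) * a) * c =
  c * (a * (n%:R * a + a)) by ring.
by rewrite !(mulr_ge0, addr_ge0).
Qed.

End RealEstimates.

Definition spoke_angle {R : realType} (K i : nat) : R := i.+1%:R * (pi / 2 / K%:R).

Section QuarterTurn.
Context {R : realType} {F : scalars} {H : hilbertSpace R F}.
Implicit Types (x y : H) (f g : H -> H).


(** A contraction that is close, on an invariant set of vectors, to a norm
    decreasing map stays close to it when both are iterated: the errors made
    at the successive steps are never amplified. *)
Lemma iter_near f g (S : set H) c n : {morph f : x y / x - y} ->
  (forall x, rnorm (f x) <= rnorm x) -> 0 <= c ->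
  (forall x, S x -> S (g x) /\ rnorm (g x) <= rnorm x) ->
  (forall x, S x -> rnorm (f x - g x) <= c * rnorm x) ->
  forall x, S x -> rnorm (iter n f x - iter n g x) <= n%:R * (c * rnorm x).
Proof.
move=> fB f1 c0 Sg fg x Sx.
have Sn m : S (iter m g x) /\ rnorm (iter m g x) <= rnorm x.
  elim: m => //= m [Sm xm]; have [Sgm gm] := Sg _ Sm; split => //.
  exact: le_trans xm.
elim: n => [|n IH]; first by rewrite subrr rnorm0 mul0r.
rewrite !iterS; set u := iter n f x in IH *; have [Sv vx] := Sn n.
set v := iter n g x in IH Sv vx *.
have -> : f u - g v = f (u - v) + (f v - g v) by rewrite fB subrKA.
rewrite (le_trans (rnormD _ _))// -natr1 mulrDl mul1r lerD//.
  exact: le_trans (f1 _) IH.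
by rewrite (le_trans (fg _ Sv))// ler_wpM2l.
Qed.

Variables e e' : H.
Hypotheses (e1 : rdot e e = 1) (e'1 : rdot e' e' = 1) (ee' : rdot e e' = 0).

Definition plane : set H := [set x | exists a b : R, x = a *:: e + b *:: e'].
Definition spoke (t : R) : H := cos t *:: e + sin t *:: e'.
Definition spoke_perp (t : R) : H := (- sin t) *:: e + cos t *:: e'.

Lemma rdot_plane a b c d :
  rdot (a *:: e + b *:: e') (c *:: e + d *:: e') = a * c + b * d.
Proof.
rewrite rdotDl !rdotDr !rdotZl !rdotZr e1 e'1 ee' rdotC ee'; ring.
Qed.

Lemma plane_comb (r s : R) x y : plane x -> plane y -> plane (r *:: x + s *:: y).
Proof.
move=> [a [b ->]] [c [d ->]]; exists (r * a + s * c), (r * b + s * d).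
by rewrite !scalerDr !scalerA -!rmorphM addrACA -!scalerDl -!rmorphD.
Qed.

Lemma plane_spoke t : plane (spoke t).
Proof. by exists (cos t), (sin t). Qed.

Lemma plane_perp t : plane (spoke_perp t).
Proof. by exists (- sin t), (cos t). Qed.

Lemma rdot_perp t : rdot (spoke_perp t) (spoke_perp t) = 1.
Proof. by rewrite rdot_plane mulrNN addrC -!expr2 cos2Dsin2. Qed.

Lemma rnorm_perp t : rnorm (spoke_perp t) = 1.
Proof. by apply/eqP; rewrite -sqrp_eq1 ?rnorm_ge0// rnorm_sqr rdot_perp. Qed.

Lemma rnorm_spoke t : rnorm (spoke t) = 1.
Proof.
apply/eqP; rewrite -sqrp_eq1 ?rnorm_ge0// rnorm_sqr rdot_plane.
by rewrite -!expr2 cos2Dsin2.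
Qed.

Lemma rdot_spoke_perp s t : rdot (spoke s) (spoke_perp t) = sin (s - t).
Proof. by rewrite rdot_plane sinB; ring. Qed.

(** Damping by the factor 1 - w in the direction orthogonal to a spoke;
    w = 1 is the projection of the plane onto the spoke. *)
Definition damp (w t : R) x : H := x - (w * rdot x (spoke_perp t)) *:: spoke_perp t.

Lemma damp_plane w t x : plane x -> plane (damp w t x).
Proof.
move=> px; have := plane_comb 1 (- (w * rdot x (spoke_perp t))) px (plane_perp t).
by rewrite rmorph1 scale1r rmorphN scaleNr.
Qed.

Lemma rdot_perp_le t x : `|rdot x (spoke_perp t)| <= rnorm x.
Proof.
rewrite ler_norml; have := rdot_le x (spoke_perp t).
have := rdot_le (- x) (spoke_perp t).
by rewrite rnormN rnorm_perp mulr1 -[- x]add0r rdotBl rdot0l sub0r lerNl => -> ->.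
Qed.

Lemma damp_contraction w t x : 0 <= w <= 1 -> rnorm (damp w t x) <= rnorm x.
Proof.
move=> /andP[w0 w1]; rewrite -ler_sqr ?nnegrE ?rnorm_ge0// /damp.
set n := spoke_perp t; rewrite rnorm_sqr rdotBl !rdotBr !rdotZl !rdotZr.
rewrite rdot_perp -rnorm_sqr (rdotC n); set c := rdot x n.
have := sqr_ge0 c; have : 0 <= w * (2 - w) by rewrite mulr_ge0//; lra.
by move=> /mulr_ge0 /[apply]; lra.
Qed.

Lemma iter_damp w t x m : iter m (damp w t) x = damp (1 - (1 - w) ^+ m) t x.
Proof.
elim: m => [|m IH]; first by rewrite expr0 subrr /damp mul0r rmorph0 scale0r subr0.
rewrite iterS IH /damp rdotBl rdotZl rdot_perp mulr1.
rewrite -addrA -opprD -scalerDl -rmorphD; congr (_ - emb _ *: _).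
by rewrite exprS; ring.
Qed.

(** A contraction that is almost the damping by 1 - w acts, after m iterations
    with m w large, almost as the projection onto the spoke. *)
Lemma iter_near_projection f w t c m x : {morph f : x y / x - y} ->
  (forall x, rnorm (f x) <= rnorm x) -> 0 <= c -> 0 <= w <= 1 ->
  (forall x, plane x -> rnorm (f x - damp w t x) <= c * rnorm x) ->
  plane x -> rnorm (iter m f x - damp 1 t x) <= (m%:R * c + (1 - w) ^+ m) * rnorm x.
Proof.
move=> fB f1 c0 w01 fw px.
rewrite -(subrKA (iter m (damp w t) x)) (le_trans (rnormD _ _))// mulrDl lerD//.
  rewrite -mulrA; apply: (iter_near _ fB f1 c0 _ fw px) => y py.
  by split; [exact: damp_plane|exact: damp_contraction].
rewrite iter_damp /damp; set a := _ * rdot _ _; set b := _ * rdot _ _.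
have -> : x - a *:: spoke_perp t - (x - b *:: spoke_perp t) =
    ((1 - w) ^+ m * rdot x (spoke_perp t)) *:: spoke_perp t.
  rewrite opprB addrC subrKA -scaleNr -scalerDl -rmorphN -rmorphD.
  by congr (emb _ *: _); rewrite /a /b; ring.
rewrite rnormZ rnorm_perp mulr1.
have w1 : 0 <= (1 - w) ^+ m by rewrite exprn_ge0// subr_ge0; case/andP: w01.
by rewrite normrM ger0_norm// ler_wpM2l// rdot_perp_le.
Qed.

(** Projecting e successively on K spokes of the quarter turn from e to e',
    at angle pi/(2K) from each other, leaves cos(pi/2K)^K e', whose length
    tends to 1 as K grows. *)
Lemma quarter_turn (K : nat) (T : nat -> H -> H) c : (0 < K)%N -> 0 <= c ->
  (forall t, {morph T t : x y / x - y}) ->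
  (forall t x, (t < K)%N -> rnorm (T t x) <= rnorm x) ->
  (forall t x, (t < K)%N -> plane x ->
     rnorm (T t x - damp 1 (spoke_angle K t) x) <= c * rnorm x) ->
  rnorm (foldl (fun x t => T t x) e (iota 0 K) - e') <= K%:R * c + 2 / K%:R.
Proof.
rewrite /spoke_angle; set th := pi / 2 / K%:R => K0 c0 TB T1 Tdamp.
have K0R : (0 : R) < K%:R by rewrite ltr0n.
have th0 : 0 <= th by rewrite !divr_ge0// pi_ge0.
have thK : th <= 2 / K%:R by rewrite ler_pM2r ?invr_gt0// ltW// pihalf_lt2.
have th2 : th <= 2 by rewrite (le_trans thK)// ler_pdivrMr// ler_pMr// ler1n.
have cos01 : 0 <= cos th <= 1.
  rewrite cos_le1 andbT cos_ge0_pihalf//; apply/andP; split.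
    by rewrite (le_trans _ th0)// oppr_le0 divr_ge0// pi_ge0.
  by rewrite ler_pdivrMr// ler_pMr ?ler1n// divr_gt0// pi_gt0.
pose ideal t := (cos th ^+ t) *:: spoke (t%:R * th).
have ideal_le1 t : rnorm (ideal t) <= 1.
  by case/andP: cos01 => *; rewrite rnormZ rnorm_spoke mulr1 ger0_norm ?exprn_ge0//.
have ideal_plane t : plane (ideal t).
  have := plane_comb (cos th ^+ t) 0 (plane_spoke (t%:R * th)) (plane_spoke 0).
  by rewrite rmorph0 scale0r addr0.
have damp_ideal t : damp 1 (t.+1%:R * th) (ideal t) = ideal t.+1.
  rewrite /damp /ideal rdotZl rdot_spoke_perp mul1r exprSr.
  set u := t.+1%:R * th.
  have -> : t%:R * th = u - th by rewrite /u -natr1; ring.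
  have -> : u - th - u = - th by ring.
  rewrite sinN /spoke /spoke_perp cosB sinB !scalerDr !scalerA -!rmorphM.
  rewrite opprD addrACA -!scalerBl -!rmorphB.
  have C2 := cos2Dsin2 th.
  by congr (emb _ *: _ + emb _ *: _); ring: C2.
have step t : (t <= K)%N ->
    rnorm (foldl (fun x t => T t x) e (iota 0 t) - ideal t) <= t%:R * c.
  elim: t => [|t IH] tK.
    rewrite /= /ideal /spoke mul0r cos0 sin0 expr0 rmorph0 scale0r addr0.
    by rewrite rmorph1 !scale1r subrr rnorm0 mul0r.
  rewrite -addn1 iotaD foldl_cat /= add0n addn1.
  set u := foldl _ _ _ in IH *.
  have -> : T t u - ideal t.+1 =
      T t (u - ideal t) + (T t (ideal t) - damp 1 (t.+1%:R * th) (ideal t)).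
    by rewrite damp_ideal TB subrKA.
  have -> : t.+1%:R * c = t%:R * c + c by rewrite -natr1 mulrDl mul1r.
  rewrite (le_trans (rnormD _ _))// lerD//.
    by rewrite (le_trans (T1 _ _ _))// IH// ltnW.
  by rewrite (le_trans (Tdamp _ _ tK (ideal_plane t)))// ler_piMr.
have idealK : ideal K = (cos th ^+ K) *:: e'.
  rewrite /ideal; have -> : K%:R * th = pi / 2 by rewrite mulrC divfK// gt_eqF.
  rewrite /spoke cos_pihalf sin_pihalf.
  by rewrite rmorph0 scale0r add0r rmorph1 scale1r.
rewrite -(subrKA (ideal K)) (le_trans (rnormD _ _))// lerD ?step//.
have -> : ideal K - e' = (cos th ^+ K - 1) *:: e'.
  by rewrite idealK rmorphB rmorph1 scalerBl scale1r.
have e'n : rnorm e' = 1 by apply/eqP; rewrite -sqrp_eq1 ?rnorm_ge0// rnorm_sqr e'1.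
rewrite rnormZ e'n mulr1 distrC ger0_norm; last first.
  by case/andP: cos01 => *; rewrite subr_ge0 exprn_ile1.
rewrite (le_trans (expr_ge_bernoulli K cos01))//.
have : 1 - cos th <= th ^+ 2 / 2 by apply: cos_ge; rewrite th0 th2.
have thsq : th ^+ 2 <= (2 / K%:R) ^+ 2 by rewrite ler_sqr// nnegrE ?divr_ge0.
move=> h; have {}h := le_trans h (ler_wpM2r (_ : 0 <= 2^-1) thsq).
rewrite (le_trans (ler_wpM2l (ltW K0R) (h _)))// ?invr_ge0//.
by rewrite le_eqVlt; apply/orP; left; apply/eqP; field; rewrite gt_eqF.
Qed.

End QuarterTurn.

(** * Weights and rates that single out one direction at a time *)

Section BlockParameters.
Context {R : realType}.
Variable K : nat.

(** Let Q be the sharpness and q = Q^-2 the gap. The direction i has the weight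
    q^(K-1-i), up to normalization, and the rate q^(2i)/n: among the numbers
    removed s i with s = 1/rate t, the one for i = t exceeds the others by a
    factor of at least 1/(2q). The integer n slows down all rates, without any
    effect on these comparisons. The value of Q makes the total error of order
    1/K in total_error. *)
Definition sharpness : nat := (7 * K ^ 3)%N.
Definition gap : R := (sharpness ^ 2)%:R^-1.
Definition weight (i : nat) : R :=
  gap ^+ (K.-1 - i) / \sum_(j < K) gap ^+ j.
(** About Q/(weight t): in so many rounds the direction t, which loses a
    proportion of at least (weight t)/2 each time, vanishes up to O(1/Q), while the
    others, which lose at most q (weight t), lose O(1/Q) altogether. *)
Definition num_rounds (t : nat) : nat := (sharpness ^ (2 * (K.-1 - t)).+1)%N.

Hypothesis K0 : (0 < K)%N.

Let Q := sharpness.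

Lemma sharpness_gt1 : (1 < Q)%N.
Proof. by have : (0 < K ^ 3)%N by [rewrite expn_gt0 K0]; rewrite /Q /sharpness; lia. Qed.

Let Q0 : (0 < Q)%N := ltnW sharpness_gt1.
Let QR : (2 : R) <= Q%:R.
Proof. by rewrite ler_nat sharpness_gt1. Qed.
Let QR0 : (0 : R) < Q%:R.
Proof. by rewrite ltr0n. Qed.

Lemma gapE : gap = Q%:R ^- 2.
Proof. by rewrite /gap natrX. Qed.

Lemma gap_gt0 : 0 < gap.
Proof. by rewrite gapE invr_gt0 exprn_gt0. Qed.

Lemma gap_le : gap <= 2^-1.
Proof.
rewrite gapE lef_pV2 ?posrE ?exprn_gt0//.
by have := QR; nra.
Qed.

Let qle1 : gap <= 1.
Proof. by rewrite (le_trans gap_le)// invf_le1// ler1n. Qed.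

Lemma weight_den : 1 <= \sum_(j < K) gap ^+ j <= 2.
Proof.
have [q0 qle] := (gap_gt0, gap_le).
apply/andP; split.
  rewrite (bigD1 (Ordinal K0))//= expr0 lerDl.
  by apply: sumr_ge0 => i _; rewrite exprn_ge0// ltW.
have := subrX1 gap K; set Z := \sum_(j < K) _ => ZE.
have qK : 0 <= gap ^+ K by rewrite exprn_ge0// ltW.
have : (1 - gap) * Z <= 1.
  by rewrite -[1 - gap]opprB mulNr -ZE; lra.
have Z0 : 0 <= Z by apply: sumr_ge0 => i _; rewrite exprn_ge0// ltW.
by nra.
Qed.

Let Z0 : 0 < \sum_(j < K) gap ^+ j.
Proof. by case/andP: weight_den => z _; rewrite (lt_le_trans _ z). Qed.

Lemma weight_gt0 i : 0 < weight i.
Proof. by rewrite divr_gt0// exprn_gt0// gap_gt0. Qed.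

Lemma weight_sum : \sum_(i < K) weight i = 1.
Proof.
rewrite -mulr_suml (reindex_inj rev_ord_inj) /=.
rewrite (eq_bigr (fun j : 'I_K => gap ^+ j)) ?divff ?gt_eqF// => j _.
by congr (_ ^+ _); have := ltn_ord j; lia.
Qed.

Lemma weightM i j : (i <= j)%N -> (j < K)%N ->
  weight i = gap ^+ (j - i) * weight j.
Proof.
move=> ij jK; rewrite /weight mulrA -exprD; congr (_ ^+ _ / _).
by lia.
Qed.

Variable n : nat.

Definition rate (i : nat) : R := (n * sharpness ^ (4 * i))%:R^-1.
Definition num_damps (t : nat) : nat := (n * sharpness ^ (4 * t))%N.
(** The amount by which s dampings of the unit vector g_i reduce the coefficient
    of its direction in the plane. *)
Definition removed (s i : nat) : R := weight i * (1 - (1 - rate i) ^+ s).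

Hypothesis n0 : (0 < n)%N.

Lemma rate_itv i : 0 <= rate i <= 1.
Proof.
rewrite /rate invr_ge0 ler0n invf_le1 ?ler1n ?ltr0n muln_gt0 n0 expn_gt0 Q0//.
Qed.

Lemma rate_le i : rate i <= n%:R^-1.
Proof.
rewrite /rate lef_pV2 ?posrE ?ltr0n ?muln_gt0 ?n0 ?expn_gt0 ?Q0//.
by rewrite ler_nat leq_pmulr// expn_gt0 Q0.
Qed.

Lemma removed_itv s i : 0 <= removed s i <= weight i.
Proof.
have /andP[r0 r1] := rate_itv i.
have c0 : 0 <= (1 - rate i) ^+ s by rewrite exprn_ge0// subr_ge0.
have c1 : (1 - rate i) ^+ s <= 1 by rewrite exprn_ile1 ?subr_ge0// gerBl.
have w0 := ltW (weight_gt0 i); rewrite /removed; apply/andP; split.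
  by rewrite mulr_ge0// subr_ge0.
by rewrite ler_piMr// gerBl.
Qed.

(** As num_damps t is the inverse of rate t, the factor (1 - rate t)^(num_damps t)
    is at most 1/2. *)
Lemma removed_diag t : weight t / 2 <= removed (num_damps t) t.
Proof.
rewrite /removed ler_pM2l ?weight_gt0//.
have := expr_le_inv (num_damps t) (rate_itv t).
rewrite /rate /num_damps mulfV ?pnatr_eq0 ?muln_eq0 ?negb_or -?lt0n ?n0 ?expn_gt0 ?Q0//.
by lra.
Qed.

(** For i < t the weight of i is small; for i > t the weight is larger by q^-(i-t),
    but the number of dampings times the rate is q^(2(i-t)). *)
Lemma removed_offdiag i t : (i < K)%N -> (t < K)%N -> i != t ->
  removed (num_damps t) i <= gap * weight t.
Proof.
move=> iK tK; have [q0 qle] := (gap_gt0, qle1).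
have qk k : (0 < k)%N -> gap ^+ k <= gap.
  by move=> k0; rewrite -[leRHS]expr1 ler_wiXn2l// ltW.
rewrite neq_ltn => /orP[it|ti].
  case/andP: (removed_itv (num_damps t) i) => _ /le_trans; apply.
  by rewrite (weightM (ltnW it) tK) ler_pM2r ?weight_gt0// qk ?subn_gt0.
have /andP[r0 r1] := rate_itv i.
have i01 : 0 <= 1 - rate i <= 1 by rewrite subr_ge0 r1 gerBl.
have := expr_ge_bernoulli (num_damps t) i01; rewrite subKr => rl.
rewrite (le_trans (ler_wpM2l (ltW (weight_gt0 i)) rl))//.
have -> : (num_damps t)%:R * rate i = gap ^+ (i - t) * gap ^+ (i - t).
  have -> : i = (t + (i - t))%N by rewrite subnKC// ltnW.
  rewrite addKn; set d := (i - t)%N; rewrite /rate /num_damps gapE.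
  have -> : (Q%:R ^- 2 : R) ^+ d * (Q%:R ^- 2) ^+ d = Q%:R ^- (4 * d).
    by rewrite -exprD -exprVn -exprM exprVn; congr (_ ^- _); lia.
  rewrite mulnDr expnD 3!natrM 2!natrX -/Q.
  have Qk k : (Q%:R ^+ k : R) != 0 by rewrite expf_neq0// gt_eqF.
  have nn : (n%:R : R) != 0 by rewrite pnatr_eq0 -lt0n.
  by rewrite invfM invfM mulrACA divff// mul1r mulrA divff// mul1r.
rewrite mulrC -mulrA -(weightM (ltnW ti) iK).
by rewrite ler_pM2r ?weight_gt0// qk ?subn_gt0.
Qed.

(** In each round the other contraction moves a vector of length at most 2 by the
    proportion d, and at most K directions lose gap * weight t; the last term is
    what is left of the direction t. *)
Lemma step_error t d : (t < K)%N -> 0 <= d <= Q%:R ^- (2 * K).+1 ->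
  (num_rounds t)%:R * (2 * d + K%:R * (gap * weight t)) +
    (1 - removed (num_damps t) t) ^+ num_rounds t <= (K%:R + 6) / Q%:R.
Proof.
move=> tK /andP[d0 dle]; have /andP[z1 z2] := weight_den.
have rw : (num_rounds t)%:R * weight t = Q%:R / \sum_(j < K) gap ^+ j.
  rewrite /num_rounds /weight gapE natrX exprS mulrA exprM -/Q.
  by rewrite exprVn mulfK// !expf_neq0// gt_eqF.
have e1 : (num_rounds t)%:R * (2 * d) <= 2 / Q%:R.
  have : (num_rounds t)%:R <= Q%:R ^+ (2 * K) :> R.
    by rewrite -natrX ler_nat /num_rounds leq_pexp2l// -/Q; lia.
  move=> h; have := ler_pM (ler0n _ _) d0 h dle.
  rewrite exprS invfM mulrCA divff ?expf_neq0 ?gt_eqF// mulr1 => {}h.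
  by rewrite mulrCA ler_pM2l.
have e2 : (num_rounds t)%:R * (K%:R * (gap * weight t)) <= K%:R / Q%:R.
  have -> : (num_rounds t)%:R * (K%:R * (gap * weight t)) =
    K%:R * (gap * ((num_rounds t)%:R * weight t)) by ring.
  rewrite rw; set Z := \sum_(j < K) _ in z1 *.
  have -> : gap * (Q%:R / Z) = Q%:R^-1 / Z.
    by rewrite gapE; field; rewrite !gt_eqF// (lt_le_trans ltr01).
  have Zi : Z^-1 <= 1 by rewrite invf_le1// (lt_le_trans ltr01).
  by rewrite ler_wpM2l// ler_piMr// invr_ge0 ltW.
have /andP[r0 r1] := removed_itv (num_damps t) t.
have w1 : weight t <= 1.
  rewrite -weight_sum (bigD1 (Ordinal tK))//= lerDl sumr_ge0// => i _.
  by rewrite ltW ?weight_gt0.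
have e3 : (1 - removed (num_damps t) t) ^+ num_rounds t <= 4 / Q%:R.
  have := expr_le_inv (num_rounds t) (_ : 0 <= removed (num_damps t) t <= 1).
  rewrite r0 (le_trans r1)// => /(_ isT).
  have : Q%:R / 4 <= (num_rounds t)%:R * removed (num_damps t) t.
    have := ler_wpM2l (ler0n R (num_rounds t)) (removed_diag t).
    rewrite mulrA rw; apply: le_trans.
    rewrite -mulrA ler_pM2l// -invfM lef_pV2 ?posrE ?mulr_gt0//.
    by lra.
  have : 0 <= (1 - removed (num_damps t) t) ^+ num_rounds t.
    by rewrite exprn_ge0// subr_ge0 (le_trans r1).
  move: (_ ^+ _) (_ * removed _ _) => a b a0 Qb ab.
  by rewrite ler_pdivlMr//; nra.
rewrite mulrDr (_ : (K%:R + 6) / Q%:R = 2 / Q%:R + K%:R / Q%:R + 4 / Q%:R).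
  by rewrite !lerD.
by field; rewrite gt_eqF.
Qed.

Lemma total_error : K%:R * ((K%:R + 6) / Q%:R) + 2 / K%:R <= 3 / K%:R :> R.
Proof.
have K1 : (1 : R) <= K%:R by rewrite ler1n.
have K00 : (0 : R) < K%:R by rewrite ltr0n.
rewrite [leRHS](_ : _ = 1 / K%:R + 2 / K%:R); last by field; rewrite gt_eqF.
rewrite lerD2r mulrA ler_pdivrMr// mulrAC ler_pdivlMr//.
have -> : Q%:R = 7 * K%:R ^+ 3 :> R by rewrite /Q /sharpness natrM natrX.
by nra.
Qed.

End BlockParameters.

(** * The quarter turn of one block *)

Section Block.
Context {R : realType} {F : scalars} {H : hilbertSpace R F}.
Variables (K n : nat) (K0 : (0 < K)%N) (n0 : (0 < n)%N).
Variables (e e' : H).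
Hypotheses (e1 : rdot e e = 1) (e'1 : rdot e' e' = 1) (ee' : rdot e e' = 0).
Variables (A B : H -> H) (d : R).
Hypotheses (AB : {morph A : x y / x - y}) (BB : {morph B : x y / x - y}).
Hypotheses (A1 : forall x, rnorm (A x) <= rnorm x).
Hypotheses (B1 : forall x, rnorm (B x) <= rnorm x).
Hypothesis d_itv : 0 <= d <= (sharpness K)%:R ^- (2 * K).+1.

Let normal i := spoke_perp e e' (spoke_angle K i).

Definition compression (s : nat) (x : H) : H :=
  x - \sum_(i < K) (removed K n s i * rdot x (normal i)) *:: normal i.

Hypothesis BA : forall s x, plane e e' x -> B (iter s A x) = B (compression s x).
Hypothesis Bid : forall x, plane e e' x -> rnorm (B x - x) <= d * rnorm x.

Definition block_run (x : H) : H :=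
  foldl (fun x t => iter (num_rounds K t) (fun y => B (iter (num_damps K n t) A y)) x)
    x (iota 0 K).

Lemma compression_plane s x : plane e e' x -> plane e e' (compression s x).
Proof.
move=> px; rewrite /compression; elim/big_rec: _ => [|i y _ py].
  by rewrite subr0.
have := plane_comb 1 (- (removed K n s i * rdot x (normal i))) py (plane_perp e e' (spoke_angle K i)).
rewrite rmorph1 scale1r rmorphN scaleNr; congr (plane _ _ _).
by rewrite opprD addrCA addrC.
Qed.

Lemma compression_near_damp t x : (t < K)%N ->
  rnorm (compression (num_damps K n t) x -
         damp e e' (removed K n (num_damps K n t) t) (spoke_angle K t) x)
  <= K%:R * (gap K * weight K t) * rnorm x.
Proof.
move=> tK; rewrite /compression (bigD1 (Ordinal tK))//= /damp opprD addrA.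
rewrite [X in rnorm X]addrAC subrr sub0r rnormN.
rewrite (le_trans (rnorm_sum _ _ _))//.
have -> : K%:R * (gap K * weight K t) * rnorm x =
    \sum_(i < K) gap K * weight K t * rnorm x.
  by rewrite sumr_const card_ord -[RHS]mulr_natl !mulrA.
have pos : 0 <= gap K * weight K t :> R.
  by apply/ltW/mulr_gt0; [exact: gap_gt0|exact: weight_gt0].
rewrite [leRHS](bigD1 (Ordinal tK))//= ler_wpDl//; first by rewrite mulr_ge0// rnorm_ge0.
apply: ler_sum => i it; rewrite rnormZ rnorm_perp// mulr1 normrM.
have /andP[r0 _] := @removed_itv R K K0 n n0 (num_damps K n t) i.
rewrite ger0_norm// ler_pM// ?rdot_perp_le//.
exact: removed_offdiag.
Qed.

Lemma rnorm_compression s x : rnorm (compression s x) <= 2 * rnorm x.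
Proof.
rewrite /compression (le_trans (rnormD _ _))// rnormN mulrDl mul1r lerD2l.
rewrite (le_trans (rnorm_sum _ _ _))// -[leRHS]mul1r -(@weight_sum R K K0).
rewrite mulr_suml ler_sum// => i _; rewrite rnormZ rnorm_perp// mulr1 normrM.
have /andP[r0 r1] := @removed_itv R K K0 n n0 s i.
by rewrite ger0_norm// ler_pM// rdot_perp_le.
Qed.

(** B A^s with s = num_damps t is almost the damping of the plane along the normal
    of the spoke t; iterated num_rounds t times, it is almost the projection onto
    that spoke, and quarter_turn applies. *)
Lemma block_rotation : rnorm (block_run e - e') <= 3 / K%:R.
Proof.
have /andP[d0 _] := d_itv.
have fB t : {morph (fun y => B (iter (num_damps K n t) A y)) : x y / x - y}.
  move=> x y; rewrite -BB; congr B.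
  by elim: (num_damps K n t) => //= s ->; rewrite AB.
have iterA1 s x : rnorm (iter s A x) <= rnorm x.
  by elim: s => //= s; apply: le_trans.
have f1 t x : rnorm (B (iter (num_damps K n t) A x)) <= rnorm x.
  exact: le_trans (B1 _) (iterA1 _ _).
have Q0 : (0 : R) < (sharpness K)%:R by rewrite ltr0n ltnW// sharpness_gt1.
apply: le_trans (total_error K0).
apply: (quarter_turn e1 e'1 ee' K0).
- by rewrite mulr_ge0 ?invr_ge0// ?addr_ge0// ltW.
- move=> t x y; elim: (num_rounds K t) => //= r ->; exact: fB.
- move=> t x _; elim: (num_rounds K t) => //= r; apply: le_trans; exact: f1.
move=> t x tK px.
have /andP[r0 r1] := @removed_itv R K K0 n n0 (num_damps K n t) t.
have w1 : weight K t <= 1 :> R.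
  rewrite -(@weight_sum R K K0) (bigD1 (Ordinal tK))//= lerDl sumr_ge0// => i _.
  by apply/ltW/weight_gt0.
apply: le_trans (ler_wpM2r (rnorm_ge0 x) (step_error K0 n0 tK d_itv)).
apply: (iter_near_projection e1 e'1 ee' (num_rounds K t) (fB t) (f1 t) (t := spoke_angle K t)
  (w := removed K n (num_damps K n t) t) (c := 2 * d + K%:R * (gap K * weight K t))) => //.
- have w0 := @weight_gt0 R K K0 t; have q0 := @gap_gt0 R K K0.
  by rewrite addr_ge0// mulr_ge0// ltW// mulr_gt0.
- by rewrite r0 (le_trans r1).
move=> y py; rewrite BA//.
rewrite -(subrKA (compression (num_damps K n t) y)) (le_trans (rnormD _ _))//.
rewrite mulrDl lerD ?compression_near_damp//.
rewrite (le_trans (Bid (compression_plane _ py)))// [2 * d]mulrC -mulrA.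
by rewrite ler_wpM2l// rnorm_compression.
Qed.

End Block.

(** * Block vectors with prescribed components in a plane *)

Section Orthocomplement.
Context {R : realType} {F : scalars} {H : hilbertSpace R F}.
Implicit Types (S : set H) (x y z : H).

Definition orthocompl S : set H := [set z | forall s, S s -> dotp H z s = 0].

Lemma orthocompl_closed S : closed_subspace (orthocompl S).
Proof.
split=> [s _|a x y xS yS s Ss|z clz s Ss]; first by rewrite dotp0l.
  by rewrite dotpDl dotpZl xS// yS// mulr0 addr0.
apply: re_mulconj_eq0; apply/eqP; rewrite eq_le re_mulconj_ge0 andbT.
set t := dotp H z s *: s.
have -> : re (dotp H z s * scalar_conj R F (dotp H z s)) = rdot z t.
  by rewrite /rdot /t dotpZr mulrC.
apply/ler_addgt0Pr => e e0; rewrite add0r.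
have t1 : 0 < 1 + rnorm t by rewrite (lt_le_trans ltr01)// lerDl rnorm_ge0.
have eps0 : (0 : scalar_field R F) < emb (e / (1 + rnorm t)).
  by rewrite -(rmorph0 emb) ltr_emb divr_gt0.
have [y [Sy]] := clz _ (nbhsx_ballx z _ eps0).
rewrite -ball_normE /= -emb_rnorm ltr_emb => zy.
have yt : rdot y t = 0 by rewrite /rdot /t dotpZr Sy// mulr0 raddf0.
rewrite -[rdot z t]subr0 -yt -rdotBl (le_trans (rdot_le _ _))//.
rewrite (le_trans (ler_wpM2r (rnorm_ge0 t) (ltW zy)))//.
by rewrite -mulrA ler_piMr ?ltW// mulrC ltr_pdivrMr// mul1r ltrDr.
Qed.

End Orthocomplement.

Section DilationMatrix.
Context {R : realType}.
Variables (K : nat) (K0 : (0 < K)%N).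

(** The upper rows are the components in the plane of the vectors to be damped. The
    lower rows are the upper ones turned by a right angle: they make the two columns
    orthonormal, and stand for vectors that are not damped. *)
Definition direction : 'M[R]_(K + K, 2) :=
  col_mx
    (\matrix_(i < K, j < 2) (Num.sqrt (weight K i) *
       (if j == ord0 then - sin (spoke_angle K i) else cos (spoke_angle K i))))
    (\matrix_(i < K, j < 2) (Num.sqrt (weight K i) *
       (if j == ord0 then cos (spoke_angle K i) else sin (spoke_angle K i)))).

Lemma direction_isometry : direction^T *m direction = 1%:M.
Proof.
rewrite tr_col_mx mul_row_col; apply/matrixP => a b; rewrite !mxE -big_split /=.
have sqw i : Num.sqrt (weight K i) * Num.sqrt (weight K i) = weight K i :> R.
  by rewrite -expr2 sqr_sqrtr// ltW// weight_gt0.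
transitivity (\sum_(i < K) (weight K i * (a == b)%:R : R)); last first.
  by rewrite -mulr_suml weight_sum// mul1r.
apply: eq_bigr => i _; rewrite !mxE.
have := cos2Dsin2 (spoke_angle K i : R).
have := sqw i; move: (weight K i : R) (Num.sqrt (weight K i : R)) => w r rw.
move: (cos (spoke_angle K i : R)) (sin (spoke_angle K i : R)) => c s cs.
case: a => -[|[|//]] ?; case: b => -[|[|//]] ?; rewrite /= ?mulr1 ?mulr0.
- by rewrite -rw -[RHS]mulr1 -cs; ring.
- by ring.
- by ring.
- by rewrite -rw -[RHS]mulr1 -cs; ring.
Qed.

(** If D^T D = 1, the rows of [D | 1 - D D^T] are orthonormal: they are orthonormal
    vectors whose first components are the rows of D. *)
Definition dilation : 'M[R]_(K + K, 2 + (K + K)) :=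
  row_mx direction (1%:M - direction *m direction^T).

Lemma dilation_coisometry : dilation *m dilation^T = 1%:M.
Proof.
rewrite tr_row_mx mul_row_col; set W := direction *m direction^T.
have WW : W *m W = W.
  by rewrite /W mulmxA -[_ *m direction^T *m direction]mulmxA direction_isometry mulmx1.
have WT : W^T = W by rewrite trmx_mul trmxK.
rewrite linearB /= trmx1 WT mulmxBl mul1mx mulmxBr mulmx1 WW subrr subr0.
by rewrite addrC subrK.
Qed.

Lemma dilation_col0 (i : 'I_K) :
  dilation (lshift K i) (lshift (K + K) ord0) =
  - (Num.sqrt (weight K i) * sin (spoke_angle K i)).
Proof. by rewrite row_mxEl col_mxEu mxE eqxx mulrN. Qed.

Lemma dilation_col1 (i : 'I_K) :
  dilation (lshift K i) (lshift (K + K) ord_max) =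
  Num.sqrt (weight K i) * cos (spoke_angle K i).
Proof. by rewrite row_mxEl col_mxEu mxE. Qed.

End DilationMatrix.

(** * The two compressions of a system of three subspaces *)

(** The coordinates of one copy of l2: axis m stands for e_m, aux m j completes the
    plane of e_m and e_(m+1) to the block m, and shadow m i is outside the hub, and
    serves to tilt the i-th damped vector of the block m. *)
Definition slot : Type := (nat + nat * nat + nat * nat)%type.
Definition axis (m : nat) : slot := inl (inl m).
Definition aux (m j : nat) : slot := inl (inr (m, j)).
Definition shadow (m i : nat) : slot := inr (m, i).

Definition block_slot (m j : nat) : slot :=
  match j with 0 => axis m | 1 => axis m.+1 | j.+2 => aux m j end.

Lemma block_slot_inj m : injective (block_slot m).
Proof.
move=> [|[|j]] [|[|j']] //= [] // => [/eqP|/eqP|->] //.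
  by rewrite ltn_eqF.
by rewrite gtn_eqF.
Qed.

Lemma block_slot_disjoint m m' j j' : odd m = odd m' -> m <> m' ->
  block_slot m j <> block_slot m' j'.
Proof.
move=> om mm'.
case: j => [|[|j]]; case: j' => [|[|j']] //= [] //.
- by move=> mE; move: om; rewrite mE /=; case: odd.
- by move=> mE; move: om; rewrite -mE /=; case: odd.
Qed.

Section Model.
Context {R : realType} {F : scalars} {H : hilbertSpace R F}.
Local Notation C := (scalar_field R F).
Variables (J : Type) (E : J -> slot -> H).
Hypothesis E_on : forall c d d', dotp H (E c d) (E c d') = (d == d')%:R.
Hypothesis E_orth : forall c c' d d', c <> c' -> dotp H (E c d) (E c' d') = 0.
Variables (K n : nat -> nat).
Hypotheses (K0 : forall m, (0 < K m)%N) (n0 : forall m, (0 < n m)%N).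

Let G m : 'M[R]_(K m + K m, 2 + (K m + K m)) := dilation (K m).
Let kap m i : R := rate (K m) (n m) i.

Definition gvec c m (i : 'I_(K m + K m)) : H :=
  \sum_(j < 2 + (K m + K m)) G m i j *:: E c (block_slot m j).

(** A unit vector tilted out of the hub: leaving the hub for the orthogonal complement
    of kvec and coming back multiplies gvec by 1 - kappa. *)
Definition kvec c m (i : 'I_(K m)) : H :=
  Num.sqrt (kap m i) *:: gvec c (lshift (K m) i) -
  Num.sqrt (1 - kap m i) *:: E c (shadow m i).

Definition hub : set H :=
  orthocompl [set s | exists c m i, s = E c (shadow m i)].

(** For each parity, a space that damps the blocks of that parity, and annihilates
    the auxiliary coordinates of the others. *)
Definition chain (par : bool) : set H :=
  orthocompl [set s | exists c m,
    (odd m == par /\ exists i : 'I_(K m), s = kvec c i) \/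
    (odd m != par /\ exists j, s = E c (aux m j))].

Definition compress (par : bool) (x : H) : H :=
  orthoproj hub (orthoproj (chain par) (orthoproj hub x)).

Let hubC : closed_subspace hub := orthocompl_closed _.
Let chainC par : closed_subspace (chain par) := orthocompl_closed _.

Lemma compressP par a x y : compress par (a *: x + y) = a *: compress par x + compress par y.
Proof. by rewrite /compress !orthoproj_linear. Qed.

Lemma compressB par : {morph compress par : x y / x - y}.
Proof. by move=> x y; rewrite /compress !orthoprojB. Qed.

Lemma compressZ par a x : compress par (a *: x) = a *: compress par x.
Proof. by rewrite /compress !orthoprojZ. Qed.

Lemma compressD par : {morph compress par : x y / x + y}.
Proof. by move=> x y; rewrite -[x]scale1r compressP !scale1r. Qed.

Lemma compress_sum par I (r : seq I) (P : pred I) (f : I -> H) :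
  compress par (\sum_(i <- r | P i) f i) = \sum_(i <- r | P i) compress par (f i).
Proof. by rewrite /compress !orthoproj_sum. Qed.

Lemma compress_contraction par x : rnorm (compress par x) <= rnorm x.
Proof.
by rewrite /compress !(le_trans (orthoproj_contraction _ _))//.
Qed.

Lemma dot_slot_gvec c m (i : 'I_(K m + K m)) (j : 'I_(2 + (K m + K m))) :
  dotp H (E c (block_slot m j)) (gvec c i) = emb (G m i j).
Proof.
rewrite dotp_sumr (bigD1 j)//= dotpZr E_on eqxx conj_emb mulr1 big1 ?addr0// => j' jj'.
rewrite dotpZr E_on (inj_eq (@block_slot_inj m)) eq_sym.
by rewrite (inj_eq (@ord_inj _)) (negbTE jj') mulr0.
Qed.

Lemma dot_slot_gvec0 c d c' m (i : 'I_(K m + K m)) :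
  c <> c' \/ (forall j, d <> block_slot m j) -> dotp H (E c d) (gvec c' i) = 0.
Proof.
move=> h; rewrite dotp_sumr big1// => j _; rewrite dotpZr.
have [cc'|cc'] := pselect (c = c'); last by rewrite E_orth// mulr0.
case: h => [//|dj]; rewrite cc' E_on; have /eqP/negbTE-> := dj j.
by rewrite mulr0.
Qed.

Lemma dot_gvec c m (i i' : 'I_(K m + K m)) :
  dotp H (gvec c i) (gvec c i') = (i == i')%:R.
Proof.
have /matrixP/(_ i i') := dilation_coisometry (R := R) (K0 m); rewrite !mxE => GG.
rewrite dotp_suml -[RHS](rmorph_nat (@emb R F)) -GG rmorph_sum/=.
by apply: eq_bigr => j _; rewrite dotpZl dot_slot_gvec -rmorphM !mxE.
Qed.

Lemma dot_gvec0 c m (i : 'I_(K m + K m)) c' m' (i' : 'I_(K m' + K m')) :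
  odd m = odd m' -> c <> c' \/ m <> m' -> dotp H (gvec c i) (gvec c' i') = 0.
Proof.
move=> om h; rewrite dotp_suml big1// => j _; rewrite dotpZl dot_slot_gvec0 ?mulr0//.
by case: h => [|mm']; [left|right => j'; exact: block_slot_disjoint].
Qed.

Lemma dot_gvec_slot0 c d c' m (i : 'I_(K m + K m)) :
  c <> c' \/ (forall j, d <> block_slot m j) -> dotp H (gvec c' i) (E c d) = 0.
Proof. by move=> h; rewrite dotpC dot_slot_gvec0// conj0. Qed.

Lemma E_shadow0 c d c' m i : (forall m i, d <> shadow m i) ->
  dotp H (E c d) (E c' (shadow m i)) = 0.
Proof.
move=> h; have [<-|cc'] := pselect (c = c'); last by rewrite E_orth.
by rewrite E_on; have /eqP/negbTE-> := h m i.
Qed.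

Lemma kap_itv m i : 0 <= kap m i <= 1.
Proof. exact: rate_itv. Qed.

Let sqk m i : Num.sqrt (kap m i) * Num.sqrt (kap m i) = kap m i.
Proof. by rewrite -expr2 sqr_sqrtr//; case/andP: (kap_itv m i). Qed.

Let sqk' m i : Num.sqrt (1 - kap m i) * Num.sqrt (1 - kap m i) = 1 - kap m i.
Proof. by rewrite -expr2 sqr_sqrtr// subr_ge0; case/andP: (kap_itv m i). Qed.

Lemma dot_gvec_shadow c m (i : 'I_(K m + K m)) c' m' i' :
  dotp H (gvec c i) (E c' (shadow m' i')) = 0.
Proof. by rewrite dot_gvec_slot0//; right => -[|[|]]. Qed.

Lemma dot_kvec c m (i i' : 'I_(K m)) :
  dotp H (kvec c i) (kvec c i') = (i == i')%:R.
Proof.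
rewrite /kvec dotpBl !dotpBr !dotpZl !dotpZr dot_gvec.
rewrite dot_gvec_shadow (dotpC (E _ _) (gvec _ _)) dot_gvec_shadow conj0 E_on.
rewrite !conj_emb (inj_eq (@lshift_inj _ _)) !mulr0 subr0 sub0r opprK !mulrA.
have -> : (shadow m i == shadow m i') = (i == i').
  by apply/eqP/eqP => [[] /ord_inj|->].
have [<-|_] := eqVneq i i'; last by rewrite !mulr0 addr0.
by rewrite -!rmorphM /= sqk sqk' !mulr1 -rmorphD /= addrC subrK rmorph1.
Qed.

Lemma dot_kvec0 c m (i : 'I_(K m)) c' m' (i' : 'I_(K m')) :
  odd m = odd m' -> c <> c' \/ m <> m' -> dotp H (kvec c i) (kvec c' i') = 0.
Proof.
move=> om h; rewrite /kvec dotpBl !dotpBr !dotpZl !dotpZr (dot_gvec0 _ _ om h).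
rewrite dot_gvec_shadow (dotpC (E _ _) (gvec _ _)) dot_gvec_shadow conj0.
suff -> : dotp H (E c (shadow m i)) (E c' (shadow m' i')) = 0.
  by rewrite !mulr0 !subr0.
have [cc'|cc'] := pselect (c = c'); last by rewrite E_orth.
rewrite cc' E_on; case: h => [//|mm'].
by case: eqP => // -[].
Qed.

Lemma dot_slot_kvec c m (j : 'I_(2 + (K m + K m))) (i : 'I_(K m)) :
  dotp H (E c (block_slot m j)) (kvec c i) =
  emb (Num.sqrt (kap m i) * G m (lshift (K m) i) j).
Proof.
rewrite /kvec dotpBr !dotpZr dot_slot_gvec E_shadow0; last by case: j => -[|[|]].
by rewrite mulr0 subr0 conj_emb -rmorphM.
Qed.

Lemma dot_slot_kvec0 c d c' m (i : 'I_(K m)) :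
  (forall m i, d <> shadow m i) ->
  c <> c' \/ (forall j, d <> block_slot m j) -> dotp H (E c d) (kvec c' i) = 0.
Proof.
move=> hd h; rewrite /kvec dotpBr !dotpZr dot_slot_gvec0// E_shadow0//.
by rewrite !mulr0 subr0.
Qed.

Lemma hub_slot c d : (forall m i, d <> shadow m i) -> hub (E c d).
Proof. by move=> h _ [c' [m [i ->]]]; exact: E_shadow0. Qed.

Lemma hub_gvec c m (i : 'I_(K m + K m)) : hub (gvec c i).
Proof. by move=> _ [c' [m' [i' ->]]]; exact: dot_gvec_shadow. Qed.

Lemma orthoproj_hub_shadow c m i : orthoproj hub (E c (shadow m i)) = 0.
Proof.
apply: orthoproj_eq => //; first by case: hubC.
by move=> y hy; rewrite subr0 dotpC hy ?conj0//; exists c, m, i.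
Qed.

Lemma orthoproj_hub_kvec c m (i : 'I_(K m)) :
  orthoproj hub (kvec c i) = Num.sqrt (kap m i) *:: gvec c (lshift (K m) i).
Proof.
rewrite /kvec orthoprojB// !orthoprojZ// orthoproj_hub_shadow scaler0 subr0.
by rewrite orthoproj_id//; exact: hub_gvec.
Qed.

Lemma compress_slot par c m (j : 'I_(2 + (K m + K m))) : odd m = par ->
  compress par (E c (block_slot m j)) =
  E c (block_slot m j) -
  \sum_(i < K m) (kap m i * G m (lshift (K m) i) j) *:: gvec c (lshift (K m) i).
Proof.
move=> om; have hj m' i' : block_slot m j <> shadow m' i' by case: j => -[|[|]].
rewrite /compress (orthoproj_id hubC (hub_slot c hj)).
set y := E c _; pose s := \sum_(i < K m) (Num.sqrt (kap m i) * G m (lshift (K m) i) j) *:: kvec c i.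
have -> : orthoproj (chain par) y = y - s.
  apply: orthoproj_eq => // [_ [c' [m' [[/eqP om' [i' ->]]|[om' [j' ->]]]]]|w cw].
  - rewrite dotpBl dotp_suml.
    have [cE|cc'] := pselect (c = c'); last first.
      rewrite dot_slot_kvec0 //; last by left.
      rewrite big1 ?subrr// => i _; rewrite dotpZl dot_kvec0 ?mulr0 ?om//.
      by left.
    have [mE|mm'] := pselect (m = m'); last first.
      rewrite dot_slot_kvec0 //; last first.
        by right => j'; apply: block_slot_disjoint; rewrite ?om.
      rewrite big1 ?subrr// => i _; rewrite dotpZl dot_kvec0 ?mulr0 ?om//.
      by right.
    subst c' m'; rewrite dot_slot_kvec (bigD1 i')//= dotpZl dot_kvec eqxx mulr1.
    rewrite big1 ?addr0 ?subrr// => i ii'.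
    by rewrite dotpZl dot_kvec (negbTE ii') mulr0.
  - have hd m1 i1 : aux m' j' <> shadow m1 i1 by [].
    have mm' : m' <> m by move=> mE; move: om'; rewrite mE om eqxx.
    have aj k : aux m' j' <> block_slot m k by case: k => [|[|k]]//= [] /mm'.
    rewrite dotpBl dotp_suml big1 ?subr0.
      have [<-|cc'] := pselect (c = c'); last by rewrite E_orth.
      by rewrite E_on; case: eqP => // /esym /aj.
    move=> i _; rewrite dotpZl dotpC dot_slot_kvec0 ?conj0 ?mulr0//.
    by right.
  rewrite opprB addrCA subrr addr0 dotp_suml big1// => i _.
  rewrite dotpZl dotpC cw ?conj0 ?mulr0//.
  by exists c, m; left; rewrite om; split => //; exists i.
rewrite orthoprojB// (orthoproj_id hubC (hub_slot c hj)) orthoproj_sum//.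
congr (_ - _); apply: eq_bigr => i _; rewrite orthoprojZ// orthoproj_hub_kvec.
by rewrite scalerA -rmorphM mulrAC sqk.
Qed.

Lemma compress_gvec par c m (i : 'I_(K m)) : odd m = par ->
  compress par (gvec c (lshift (K m) i)) = (1 - kap m i) *:: gvec c (lshift (K m) i).
Proof.
move=> om; rewrite {1}/gvec compress_sum.
under eq_bigr do rewrite compressZ compress_slot// scalerBr scaler_sumr.
rewrite sumrB -/(gvec c (lshift (K m) i)) rmorphB rmorph1 scalerBl scale1r.
congr (_ - _); rewrite exchange_big/= (bigD1 i)//= [X in _ + X]big1 ?addr0.
  under eq_bigr do rewrite scalerA -rmorphM mulrCA.
  rewrite -scaler_suml -rmorph_sum -mulr_sumr.
  have /matrixP/(_ (lshift (K m) i) (lshift (K m) i)) := dilation_coisometry (R := R) (K0 m).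
  rewrite !mxE eqxx => GG; congr (emb _ *: _).
  transitivity (kap m i * true%:R); last by rewrite mulr1.
  by rewrite -GG; congr (_ * _); apply: eq_bigr => j _; rewrite !mxE.
move=> i' ii'; under eq_bigr do rewrite scalerA -rmorphM mulrCA.
rewrite -scaler_suml -rmorph_sum -mulr_sumr.
have /matrixP/(_ (lshift (K m) i) (lshift (K m) i')) := dilation_coisometry (R := R) (K0 m).
rewrite !mxE (inj_eq (@lshift_inj _ _)) eq_sym (negbTE ii') => GG.
rewrite (_ : \sum_j _ = 0) ?mulr0 ?rmorph0 ?scale0r// -[RHS]GG.
by apply: eq_bigr => j _; rewrite !mxE.
Qed.

(** The vectors gvec of one block are orthonormal, so powers of the compression are
    computed in an eigenbasis. *)
Lemma iter_compress_slot par c m (j : 'I_(2 + (K m + K m))) s : odd m = par ->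
  iter s (compress par) (E c (block_slot m j)) =
  E c (block_slot m j) -
  \sum_(i < K m) ((1 - (1 - kap m i) ^+ s) * G m (lshift (K m) i) j) *::
     gvec c (lshift (K m) i).
Proof.
move=> om; elim: s => [|s IH].
  by rewrite big1 ?subr0// => i _; rewrite expr0 subrr mul0r rmorph0 scale0r.
rewrite iterS IH compressB compress_slot// -addrA -opprD compress_sum -big_split/=.
congr (_ - _); apply: eq_bigr => i _.
rewrite compressZ compress_gvec// scalerA -rmorphM -scalerDl -rmorphD.
by congr (emb _ *: _); rewrite exprS; ring.
Qed.

Lemma compress_aux par c m j : odd m != par -> compress par (E c (aux m j)) = 0.
Proof.
move=> om; rewrite /compress [X in orthoproj (chain _) X]orthoproj_id//; last exact: hub_slot.
have -> : orthoproj (chain par) (E c (aux m j)) = 0.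
  apply: orthoproj_eq => //; first by case: (chainC par).
  move=> w cw; rewrite subr0 dotpC cw ?conj0//.
  by exists c, m; right; split => //; exists j.
exact: orthoproj0.
Qed.

Lemma compress_axis0 c : compress true (E c (axis 0)) = E c (axis 0).
Proof.
have hd m i : axis 0 <> shadow m i by [].
rewrite /compress (orthoproj_id hubC (hub_slot c hd)) [orthoproj (chain _) _]orthoproj_id//.
  by rewrite orthoproj_id//; exact: hub_slot.
move=> _ [c' [m [[om [i ->]]|[om [j ->]]]]].
  by rewrite dot_slot_kvec0//; right => -[|[|j]]//= [mE]; move: om; rewrite -mE.
have [<-|cc'] := pselect (c = c'); last by rewrite E_orth.
by rewrite E_on.
Qed.

End Model.

(** * From one axis to the next *)

Section Transfer.
Context {R : realType} {F : scalars} {H : hilbertSpace R F}.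
Variables (J : Type) (E : J -> slot -> H).
Hypothesis E_on : forall c d d', dotp H (E c d) (E c d') = (d == d')%:R.
Hypothesis E_orth : forall c c' d d', c <> c' -> dotp H (E c d) (E c' d') = 0.
Variables (K n : nat -> nat).
Hypotheses (K0 : forall m, (0 < K m)%N) (n0 : forall m, (0 < n m)%N).

Let tol m : R := (sharpness (K m))%:R ^- (2 * K m).+1.

(* Each block is damped so slowly that it hardly moves the axes during the
   runs of the two neighbouring blocks. *)
Hypothesis slow_next : forall m, (K m.+1)%:R / (n m.+1)%:R <= tol m / 2.
Hypothesis slow_prev : forall m, (K m)%:R / (n m)%:R <= tol m.+1 / 2.

Lemma rdotE c d d' : rdot (E c d) (E c d') = (d == d')%:R.
Proof. by rewrite /rdot E_on -(rmorph_nat (@emb R F)) embK. Qed.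

Lemma axis_on c m : rdot (E c (axis m)) (E c (axis m)) = 1.
Proof. by rewrite rdotE eqxx. Qed.

Lemma axis_orth c m : rdot (E c (axis m)) (E c (axis m.+1)) = 0.
Proof.
rewrite rdotE (_ : (axis m == axis m.+1) = false)//.
by apply/eqP => -[] /eqP; rewrite ltn_eqF.
Qed.

Lemma dilation_le1 m i j : `|dilation (K m) i j : R| <= 1.
Proof.
move: (dilation (K m)) (dilation_coisometry (R := R) (K0 m)) => D /matrixP/(_ i i).
rewrite !mxE eqxx (bigD1 j)//= [X in _ * X]mxE -expr2 => S1.
rewrite -ler_sqr ?nnegrE// expr1n -normrX ger0_norm ?sqr_ge0//.
rewrite -[leRHS]/(true%:R) -S1 lerDl sumr_ge0// => k _.
by rewrite !mxE -expr2 sqr_ge0.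
Qed.

Lemma rnorm_gvec c m (i : 'I_(K m + K m)) : rnorm (gvec E c i) = 1.
Proof.
apply/eqP; rewrite -sqrp_eq1 ?rnorm_ge0// rnorm_sqr /rdot.
by rewrite (dot_gvec E_on K0) eqxx -(rmorph_nat (@emb R F)) embK.
Qed.

Lemma compress_slot_near par c m (j : 'I_(2 + (K m + K m))) : odd m = par ->
  rnorm (compress E K n par (E c (block_slot m j)) - E c (block_slot m j)) <=
  (K m)%:R / (n m)%:R.
Proof.
move=> om; rewrite compress_slot// addrAC subrr sub0r rnormN.
rewrite (le_trans (rnorm_sum _ _ _))//.
have -> : (K m)%:R / (n m)%:R = \sum_(i < K m) (n m)%:R^-1 :> R.
  by rewrite sumr_const card_ord -[RHS]mulr_natl.
apply: ler_sum => i _; rewrite rnormZ rnorm_gvec mulr1 normrM.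
have /andP[k0 _] := @rate_itv R (K m) (K0 m) (n m) (n0 m) i.
rewrite ger0_norm// -[leRHS]mulr1 ler_pM//; last exact: dilation_le1.
exact: rate_le.
Qed.

Lemma compress_plane_near c m y : plane (E c (axis m)) (E c (axis m.+1)) y ->
  rnorm (compress E K n (~~ odd m) y - y) <= tol m * rnorm y.
Proof.
move=> [a [b ->]]; set e := E c (axis m); set e' := E c (axis m.+1).
have xx := rdot_plane (axis_on c m) (axis_on c m.+1) (axis_orth c m) a b a b.
have tol0 : 0 <= tol m by rewrite invr_ge0 exprn_ge0.
have Be' : rnorm (compress E K n (~~ odd m) e' - e') <= tol m / 2.
  apply: le_trans (slow_next m).
  exact: (@compress_slot_near (~~ odd m) c m.+1 (lshift _ ord0)).
have Be : rnorm (compress E K n (~~ odd m) e - e) <= tol m / 2.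
  rewrite /e; case: m {e e' xx Be'} tol0 => [|m] tol0.
    by rewrite compress_axis0// subrr rnorm0 divr_ge0.
  apply: le_trans (slow_prev m); rewrite /= negbK.
  exact: (@compress_slot_near (odd m) c m (lshift _ ord_max)).
set x := a *:: e + b *:: e' in xx *.
have ax : `|a| <= rnorm x.
  rewrite -ler_sqr ?nnegrE ?rnorm_ge0// rnorm_sqr xx -normrX ger0_norm ?sqr_ge0//.
  by rewrite lerDl -expr2 sqr_ge0.
have bx : `|b| <= rnorm x.
  rewrite -ler_sqr ?nnegrE ?rnorm_ge0// rnorm_sqr xx -normrX ger0_norm ?sqr_ge0//.
  by rewrite lerDr -expr2 sqr_ge0.
have -> : compress E K n (~~ odd m) x - x =
    a *:: (compress E K n (~~ odd m) e - e) + b *:: (compress E K n (~~ odd m) e' - e').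
  by rewrite compressD// !compressZ// !scalerBr addrACA -opprD.
rewrite (le_trans (rnormD _ _))// !rnormZ.
have -> : tol m * rnorm x = rnorm x * (tol m / 2) + rnorm x * (tol m / 2).
  by field.
by rewrite lerD// ler_pM// rnorm_ge0.
Qed.

(** On the plane of the block m, powers of its own compression followed by
    the compression of the other parity is the two dimensional damping: the other
    parity kills the auxiliary coordinates. *)
Lemma compress_compression c m s x : plane (E c (axis m)) (E c (axis m.+1)) x ->
  compress E K n (~~ odd m) (iter s (compress E K n (odd m)) x) =
  compress E K n (~~ odd m)
    (compression (K m) (n m) (E c (axis m)) (E c (axis m.+1)) s x).
Proof.
move=> [a [b ->]]; set e := E c (axis m); set e' := E c (axis m.+1).
set A := compress E K n (odd m); set B := compress E K n (~~ odd m).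
have iterA_lin r (u v : R) y z : iter r A (u *:: y + v *:: z) =
    u *:: iter r A y + v *:: iter r A z.
  by elim: r => //= r ->; rewrite /A compressD// !compressZ.
rewrite iterA_lin.
have -> : iter s A e = _ := iter_compress_slot E_on E_orth K0 n0 c (lshift _ ord0) s erefl.
have -> : iter s A e' = _ := iter_compress_slot E_on E_orth K0 n0 c (lshift _ ord_max) s erefl.
rewrite !scalerBr addrACA -opprD /B compressB// [in RHS]/compression compressB//.
congr (_ - _); rewrite !scaler_sumr -big_split/= !compress_sum//.
apply: eq_bigr => i _; rewrite !scalerA -!rmorphM -scalerDl -rmorphD !compressZ//.
have Bg : compress E K n (~~ odd m) (gvec E c (lshift (K m) i)) =
    Num.sqrt (weight (K m) i) *::
    compress E K n (~~ odd m) (spoke_perp e e' (spoke_angle (K m) i)).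
  rewrite /gvec compress_sum// big_split_ord/= [X in _ + X]big1 ?addr0; last first.
    by move=> j _; rewrite compressZ// compress_aux ?scaler0//; case: odd.
  rewrite !big_ord_recl big_ord0 addr0 /= /spoke_perp.
  rewrite (_ : lift ord0 ord0 = ord_max); last exact: val_inj.
  rewrite dilation_col0 dilation_col1 compressD// !compressZ// scalerDr !scalerA -!rmorphM.
  by rewrite mulrN.
rewrite Bg scalerA -rmorphM dilation_col0 dilation_col1 /removed; congr (emb _ *: _).
rewrite (rdot_plane (axis_on c m) (axis_on c m.+1) (axis_orth c m)).
have : Num.sqrt (weight (K m) i) * Num.sqrt (weight (K m) i) = weight (K m) i :> R.
  by rewrite -expr2 sqr_sqrtr// ltW// weight_gt0.
move: (weight (K m) i : R) (Num.sqrt (weight (K m) i : R)) => w r <-.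
move: (_ ^+ s) => q; by ring.
Qed.

Lemma block_transfer c m :
  rnorm (block_run (K m) (n m) (compress E K n (odd m)) (compress E K n (~~ odd m))
    (E c (axis m)) - E c (axis m.+1)) <= 3 / (K m)%:R.
Proof.
apply: (block_rotation (K0 m) (n0 m) (axis_on c m) (axis_on c m.+1)
  (axis_orth c m) (d := tol m)).
- exact: compressB.
- exact: compressB.
- exact: compress_contraction.
- exact: compress_contraction.
- by rewrite lexx andbT invr_ge0 exprn_ge0.
- by move=> s x; exact: compress_compression.
- by move=> x; exact: compress_plane_near.
Qed.

End Transfer.

(** * Words in the projections *)

Section Words.
Context {R : realType} {F : scalars} {H : hilbertSpace R F}.

Section Act.
Variables (L : nat) (Xs : 'I_L -> set H).

Definition act (w : seq 'I_L) (x : H) : H := foldl (fun x l => orthoproj (Xs l) x) x w.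

Lemma act_cat w w' x : act (w ++ w') x = act w' (act w x).
Proof. exact: foldl_cat. Qed.

Lemma act_flatten_nseq r w x : act (flatten (nseq r w)) x = iter r (act w) x.
Proof. by elim: r x => // r IH x; rewrite /= act_cat IH -iterSr. Qed.

Lemma act_flatten_map (f : nat -> seq 'I_L) s x :
  act (flatten (map f s)) x = foldl (fun x t => act (f t) x) x s.
Proof. by elim: s x => //= t s IH x; rewrite act_cat IH. Qed.

End Act.
End Words.

Section InfiniteWord.
Variables (T : Type) (t0 : T) (w : nat -> seq T).
Hypothesis w0 : forall m, (0 < size (w m))%N.

Definition prefix_word (m : nat) : seq T := flatten (map w (iota 0 m)).

(** The infinite word w 0 w 1 w 2 ..., read off its prefixes: as no word is
    empty the letter i lies within the first i + 1 words. *)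
Definition infinite_word (i : nat) : T := nth t0 (prefix_word i.+1) i.

Lemma prefix_wordS m : prefix_word m.+1 = prefix_word m ++ w m.
Proof. by rewrite /prefix_word -addn1 iotaD map_cat flatten_cat /= cats0. Qed.

Lemma size_prefix_word m : (m <= size (prefix_word m))%N.
Proof.
elim: m => // m IH; rewrite prefix_wordS size_cat -addn1 leq_add//.
Qed.

Lemma nth_prefix_word m m' i : (m <= m')%N -> (i < size (prefix_word m))%N ->
  nth t0 (prefix_word m') i = nth t0 (prefix_word m) i.
Proof.
move=> /subnKC <-; elim: (m' - m)%N => [|d IH] im; first by rewrite addn0.
rewrite addnS prefix_wordS nth_cat; case: ltnP => [_|]; first exact: IH.
rewrite leqNgt; case/negP.
elim: d {IH} => [|d IH]; first by rewrite addn0.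
by rewrite addnS prefix_wordS size_cat ltn_addr.
Qed.

Lemma infinite_wordE m i : (i < size (prefix_word m))%N ->
  infinite_word i = nth t0 (prefix_word m) i.
Proof.
move=> im; have [mi|im'] := leqP m i.+1; first exact: nth_prefix_word.
by rewrite /infinite_word -(@nth_prefix_word i.+1 m)// ?size_prefix_word// ltnW.
Qed.

End InfiniteWord.

Lemma iterates_infinite_word (R : realType) (F : scalars) (H : hilbertSpace R F)
    (L : nat) (Xs : 'I_L -> set H) (l0 : 'I_L) (w : nat -> seq 'I_L) m x :
  (forall m, (0 < size (w m))%N) ->
  iterates Xs (infinite_word l0 w) x (size (prefix_word w m)) =
  act Xs (prefix_word w m) x.
Proof.
move=> w0; set p := prefix_word w m.
suff h i : (i <= size p)%N -> iterates Xs (infinite_word l0 w) x i = act Xs (take i p) x.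
  by rewrite h// take_size.
elim: i => [|i IH] ip; first by rewrite take0.
rewrite (take_nth l0 ip) -cats1 act_cat -(IH (ltnW ip)).
by rewrite -(infinite_wordE l0 w0 ip).
Qed.

(** * Total orthonormal systems made of sequences *)

Section OrthonormalSystem.
Context {R : realType} {F : scalars} {H : hilbertSpace R F}.
Implicit Types (s t : nat -> H) (z : H).

Definition orthonormal_seq s := forall a b, dotp H (s a) (s b) = (a == b)%:R.

Lemma normalize z : z != 0 -> exists a, dotp H (a *: z) (a *: z) = 1.
Proof.
move=> z0; have nz : rnorm z != 0 by apply: contraNneq z0 => /rnorm_eq0 ->.
exists (emb (rnorm z)^-1); rewrite dotpZl dotpZr conj_emb dotp_norm -emb_rnorm.
by rewrite -rmorphXn -!rmorphM expr2 mulKf// mulVf// rmorph1.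
Qed.

(** Choosing unit vectors greedily in N, each orthogonal to the previous ones,
    either never stops or exhausts N. *)
Lemma greedy_orthonormal (N : set H) :
  (forall a z, N z -> N (a *: z)) ->
  exists s, (orthonormal_seq s /\ forall n, N (s n)) \/
    exists d, [/\ forall a b, (a < d)%N -> (b < d)%N ->
                    dotp H (s a) (s b) = (a == b)%:R,
      forall a, (a < d)%N -> N (s a) &
      forall z, N z -> (forall a, (a < d)%N -> dotp H z (s a) = 0) -> z = 0].
Proof.
move=> NZ.
pose cand (l : seq H) := [set u : H | [/\ N u, dotp H u u = 1 &
  forall v, List.In v l -> dotp H u v = 0]].
pose l := fix l n : seq H := if n is m.+1 then xget 0 (cand (l m)) :: l m else [::].
pose s n := xget 0 (cand (l n)).
have in_l n m : (m < n)%N -> List.In (s m) (l n).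
  elim: n => // n IH; rewrite ltnS leq_eqVlt => /predU1P[->|/IH]; first by left.
  by right.
have sP n : cand (l n) !=set0 -> cand (l n) (s n).
  by move=> [u cu]; rewrite /s; case: xgetP => [y _ //|/(_ u)].
have ON d : (forall a, (a < d)%N -> cand (l a) !=set0) ->
    forall a b, (a < d)%N -> (b < d)%N -> dotp H (s a) (s b) = (a == b)%:R.
  move=> cd; suff ltab a b : (a < d)%N -> (b < a)%N -> dotp H (s a) (s b) = 0.
    move=> a b ad bd; case: (ltngtP a b) => [ab|ba|<-].
    - by rewrite dotpC ltab// conj0.
    - by rewrite ltab.
    - by have [_ -> _] := sP _ (cd _ ad).
  by move=> ad ba; have [_ _] := sP _ (cd _ ad); apply; exact: in_l.
have [allc|] := pselect (forall n, cand (l n) !=set0).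
  exists s; left; split=> [a b|n]; last by have [] := sP _ (allc n).
  by apply: (ON (maxn a b).+1); rewrite ?ltnS ?leq_maxl ?leq_maxr.
move=> /existsNP[n0 cn0].
have exd : exists n, `[< ~ (cand (l n) !=set0) >] by exists n0; exact/asboolP.
case: (ex_minnP exd) => d /asboolP cd dmin.
have cnd a : (a < d)%N -> cand (l a) !=set0.
  move=> ad; apply: contrapT => /asboolP/dmin.
  by rewrite leqNgt ad.
exists s; right; exists d; split; first exact: ON.
  by move=> a /cnd/sP[].
move=> z Nz zs; apply: contrapT => /eqP z0; apply: cd.
have [a az] := normalize z0; exists (a *: z); split => //; first exact: NZ.
have l_in v : forall m, List.In v (l m) -> exists2 k, (k < m)%N & v = s k.
  elim=> //= m IH [<-|/IH[k km ->]]; first by exists m.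
  by exists k => //; exact: ltnW.
by move=> v /l_in[k kd ->]; rewrite dotpZl zs// mulr0.
Qed.

(** Zorn's lemma provides a maximal family of mutually orthogonal orthonormal
    sequences. Its orthogonal complement contains no orthonormal sequence, hence
    is finite dimensional, and one of the sequences can absorb it. Maximal families
    of sequences, instead of vectors, give an index set of the form I * nat
    without cardinal arithmetic. *)
Lemma orthonormal_system : infinite_dimensional H ->
  exists (I : Type) (e : I -> nat -> H), [/\ forall i, orthonormal_seq (e i),
    forall i j a b, i <> j -> dotp H (e i a) (e j b) = 0 &
    forall z, (forall i a, dotp H z (e i a) = 0) -> z = 0].
Proof.
move=> Hinf.
pose good := [set T : set (nat -> H) | (forall s, T s -> orthonormal_seq s) /\
  forall s t, T s -> T t -> s <> t -> forall a b, dotp H (s a) (t b) = 0].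
have [|T [[Ton Torth] Tmax]] := @Zorn_bigcup _ good.
  move=> FF Fgood Ftot; split=> [s [X FX Xs]|s t [X FX Xs] [Y FY Yt]].
    by have [+ _] := Fgood _ FX; apply.
  have [XY|YX] := Ftot _ _ FX FY.
    by have [_] := Fgood _ FY; apply => //; exact: XY.
  by have [_] := Fgood _ FX; apply => //; exact: YX.
pose N := [set z | forall s a, T s -> dotp H z (s a) = 0].
have [|f [[fon Nf]|[d [fon Nf fmax]]]] := @greedy_orthonormal N.
- by move=> a z Nz s b Ts; rewrite dotpZl Nz// mulr0.
- exfalso; have nTf : ~ T f.
    by move=> Tf; have := fon 0 0; rewrite (Nf 0%N f 0%N Tf) => /eqP; rewrite eq_sym oner_eq0.
  apply: (Tmax (T `|` [set f])).
    split; first by move=> s; left.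
    by move=> /(_ f (or_intror erefl)).
  split=> [s [/Ton//|->//]|s t [Ts|->] [Tt|->] st a b] //.
  - exact: Torth.
  - by rewrite dotpC Nf// conj0.
  - by rewrite Nf.
have [[s0 Ts0]|T0] := pselect (T !=set0); last first.
  exfalso; apply: Hinf; exists d, (fun i : 'I_d => f i) => x.
  exists (fun i => dotp H x (f i)); apply/eqP; rewrite -subr_eq0; apply/eqP.
  apply: fmax => [s a Ts|a ad]; first by exfalso; apply: T0; exists s.
  rewrite dotpBl dotp_suml (bigD1 (Ordinal ad))//= dotpZl fon// eqxx mulr1.
  rewrite big1 ?addr0 ?subrr// => i ia; rewrite dotpZl fon//.
  by rewrite (_ : (i == a :> nat) = false) ?mulr0//; apply/negbTE.
(* the finite remainder f is put in front of the sequence s0 *)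
pose e (i : {s | T s}) : nat -> H := if `[< sval i = s0 >]
  then fun m => if (m < d)%N then f m else s0 (m - d)%N else sval i.
have Nfs a s b : (a < d)%N -> T s -> dotp H (f a) (s b) = 0 by move=> ad; exact: Nf.
have Nsf a s b : (a < d)%N -> T s -> dotp H (s b) (f a) = 0.
  by move=> ad Ts; rewrite dotpC Nfs// conj0.
exists {s | T s}, e; split.
- move=> [s Ts]; rewrite /e /=; case: asboolP => [_|_]; last exact: Ton.
  move=> a b; case: (ltnP a d) => ad; case: (ltnP b d) => bd.
  + exact: fon.
  + by rewrite Nfs// ltn_eqF// (leq_trans ad).
  + by rewrite Nsf// gtn_eqF// (leq_trans bd).
  + by rewrite Ton// -(eqn_add2r d) !subnK.
- move=> [s Ts] [t Tt] a b st; have {}st : s <> t.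
    by move=> sE; apply: st; subst t; congr exist; exact: Prop_irrelevance.
  rewrite /e /=; case: asboolP => [sE|_]; case: asboolP => [tE|_].
  + by case: st; rewrite sE tE.
  + by case: ifP => ad; [exact: Nfs|apply: Torth => //; rewrite -sE].
  + by case: ifP => bd; [exact: Nsf|apply: Torth => //; rewrite -tE].
  + exact: Torth.
move=> z ze; apply: fmax => [s a Ts|a ad]; last first.
  by have := ze (exist _ s0 Ts0) a; rewrite /e /=; case: asboolP => // _; rewrite ad.
have := ze (exist _ s Ts); rewrite /e /=; case: asboolP => [->|_ //].
by move=> /(_ (a + d)%N); rewrite ltnNge leq_addl addnK.
Qed.

End OrthonormalSystem.

(** * The infinite word and the divergence of its iterates *)

Section BlockWords.

(** The block m contributes an error 3/(block_width m) = 2^-m/8, and all blocks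
    together 1/4 at most. *)
Definition block_width (m : nat) : nat := (24 * 2 ^ m)%N.
Definition tolerance_inv (m : nat) : nat :=
  (sharpness (block_width m) ^ (2 * block_width m).+1)%N.
(** The product of the inverse tolerances of both neighbours dominates each of
    them. *)
Definition slowness (m : nat) : nat :=
  (2 * block_width m * tolerance_inv m.+1 * tolerance_inv m.-1)%N.

Definition compress_word (par : bool) : seq 'I_3 :=
  [:: ord0; (if par then inord 2 else inord 1); ord0].

Definition run_word (K n : nat) (par : bool) : seq 'I_3 :=
  flatten [seq flatten (nseq (num_rounds K t)
      (flatten (nseq (num_damps K n t) (compress_word par)) ++ compress_word (~~ par)))
    | t <- iota 0 K].

Definition block_word (m : nat) : seq 'I_3 :=
  run_word (block_width m) (slowness m) (odd m).

Lemma size_run_word K n par : (0 < K)%N -> (0 < size (run_word K n par))%N.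
Proof.
move=> K0; rewrite /run_word.
have r0 : (0 < num_rounds K 0)%N by rewrite expn_gt0 ltnW// sharpness_gt1.
have -> : iota 0 K = 0%N :: iota 1 K.-1 by rewrite -[in LHS](prednK K0).
rewrite map_cons size_cat; case: (num_rounds K 0) r0 => // r _.
by rewrite ltn_addr// size_cat ltn_addr// size_cat ltn_addl.
Qed.

Lemma block_width_gt0 m : (0 < block_width m)%N.
Proof. by rewrite muln_gt0 expn_gt0. Qed.

Lemma tolerance_inv_gt0 m : (0 < tolerance_inv m)%N.
Proof.
have Q1 := sharpness_gt1 (block_width_gt0 m).
by rewrite expn_gt0 (ltnW Q1).
Qed.

Lemma slowness_gt0 m : (0 < slowness m)%N.
Proof.
rewrite /slowness muln_gt0 tolerance_inv_gt0 andbT muln_gt0 tolerance_inv_gt0 andbT.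
by rewrite muln_gt0 block_width_gt0.
Qed.

Lemma size_block_word m : (0 < size (block_word m))%N.
Proof. exact/size_run_word/block_width_gt0. Qed.

Variable R : realType.

Let inv_le (a b c : nat) : (0 < a)%N -> (0 < b)%N -> (0 < c)%N ->
  (a%:R / (2 * a * b * c)%N%:R <= b%:R^-1 / 2 :> R) /\
  (a%:R / (2 * a * b * c)%N%:R <= c%:R^-1 / 2 :> R).
Proof.
move=> a0 b0 c0; rewrite !natrM.
have [aR bR cR] : [/\ (1 : R) <= a%:R, (1 : R) <= b%:R & (1 : R) <= c%:R].
  by rewrite !ler1n.
have [a1 b1 c1] : [/\ (0 : R) < a%:R, (0 : R) < b%:R & (0 : R) < c%:R].
  by rewrite !ltr0n.
have bi : b%:R^-1 <= 1 :> R by rewrite invf_le1.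
have ci : c%:R^-1 <= 1 :> R by rewrite invf_le1.
have -> : a%:R / (2 * a%:R * b%:R * c%:R) = b%:R^-1 * c%:R^-1 / 2 :> R.
  by field; rewrite !gt_eqF.
by split; rewrite ler_pM2r ?invr_gt0// ?ler_piMr ?ler_piMl// invr_ge0 ltW.
Qed.

Lemma slowness_next m : (block_width m.+1)%:R / (slowness m.+1)%:R <=
  (sharpness (block_width m))%:R ^- (2 * block_width m).+1 / 2 :> R.
Proof.
have [_] := inv_le (block_width_gt0 m.+1) (tolerance_inv_gt0 m.+2) (tolerance_inv_gt0 m).
by rewrite [(tolerance_inv m)%:R]natrX.
Qed.

Lemma slowness_prev m : (block_width m)%:R / (slowness m)%:R <=
  (sharpness (block_width m.+1))%:R ^- (2 * block_width m.+1).+1 / 2 :> R.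
Proof.
have [+ _] := inv_le (block_width_gt0 m) (tolerance_inv_gt0 m.+1) (tolerance_inv_gt0 m.-1).
by rewrite [(tolerance_inv m.+1)%:R]natrX.
Qed.

End BlockWords.

Section ActTheory.
Context {R : realType} {F : scalars} {H : hilbertSpace R F}.
Variables (L : nat) (Xs : 'I_L -> set H).
Hypothesis Xc : forall l, closed_subspace (Xs l).

Lemma act_linear w a x y : act Xs w (a *: x + y) = a *: act Xs w x + act Xs w y.
Proof. by elim: w x y => //= l w IH x y; rewrite orthoproj_linear. Qed.

Lemma actB w : {morph act Xs w : x y / x - y}.
Proof. by move=> x y; rewrite addrC -scaleN1r act_linear scaleN1r addrC. Qed.

Lemma act_contraction w x : rnorm (act Xs w x) <= rnorm x.
Proof.
elim: w x => //= l w IH x; rewrite (le_trans (IH _))//.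
exact: orthoproj_contraction.
Qed.

Lemma act_invariant (N : set H) w x :
  (forall l y, N y -> N (orthoproj (Xs l) y)) -> N x -> N (act Xs w x).
Proof. by move=> NX; elim: w x => //= l w IH x Nx; exact/IH/NX. Qed.

End ActTheory.

(** If each equation defining a subspace either only involves N or does not
    involve N at all, then the projection onto it commutes with the one onto N. *)
Lemma orthoproj_invariant (R : realType) (F : scalars) (H : hilbertSpace R F)
    (N S : set H) : closed_subspace N ->
  (forall s, S s -> N s \/ forall y, N y -> dotp H y s = 0) ->
  forall y, N y -> N (orthoproj (orthocompl S) y).
Proof.
move=> Nc NS y Ny; set M := orthocompl S.
have Mc : closed_subspace M by exact: orthocompl_closed.
have projM p : M p -> M (orthoproj N p).
  move=> Mp s Ss; have [Nq pq] := orthoprojP Nc p.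
  case: (NS _ Ss) => [Ns|]; last exact.
  by have := pq _ Ns; rewrite dotpBl Mp// sub0r => /eqP; rewrite oppr_eq0 => /eqP.
have [Mp yp] := orthoprojP Mc y; set p := orthoproj M y in Mp yp *.
suff -> : p = orthoproj N p by case: (orthoprojP Nc p).
have [Nq pq] := orthoprojP Nc p.
apply: orthoproj_eq => // [|w Mw]; first exact: projM.
have [Nw' ww'] := orthoprojP Nc w; set w' := orthoproj N w in Nw' ww'.
have Mw' : M w' by exact: projM.
have perp u : N u -> dotp H u (w - w') = 0 by move=> Nu; rewrite dotpC ww'// conj0.
(* w' is in M, and w - w' is orthogonal to N *)
rewrite -[w](subrK w') dotpDr dotpBl (perp y Ny) (perp _ Nq) subrr add0r.
rewrite dotpBl -[dotp H y w'](subrK (dotp H p w')) -dotpBl yp// add0r.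
by rewrite -dotpBl pq.
Qed.

Section Divergence.
Context {R : realType} {F : scalars} {H : hilbertSpace R F}.
Variables (J : Type) (E : J -> slot -> H).
Hypothesis E_on : forall c d d', dotp H (E c d) (E c d') = (d == d')%:R.
Hypothesis E_orth : forall c c' d d', c <> c' -> dotp H (E c d) (E c' d') = 0.

Definition three_spaces (l : 'I_3) : set H :=
  if l == ord0 then hub E else chain E block_width slowness (l == inord 2).

Lemma three_spaces_closed l : closed_subspace (three_spaces l).
Proof. by rewrite /three_spaces; case: ifP => _; exact: orthocompl_closed. Qed.

Lemma act_compress_word par x :
  act three_spaces (compress_word par) x = compress E block_width slowness par x.
Proof.
rewrite /act /= /three_spaces eqxx /compress.
have in20 : (inord 2 == ord0 :> 'I_3) = false by rewrite -val_eqE/= inordK.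
have in10 : (inord 1 == ord0 :> 'I_3) = false by rewrite -val_eqE/= inordK.
have in12 : (inord 1 == inord 2 :> 'I_3) = false by rewrite -val_eqE/= !inordK.
by case: par; rewrite ?in20 ?in10 ?in12 ?eqxx.
Qed.

Lemma act_block_word m x : act three_spaces (block_word m) x =
  block_run (block_width m) (slowness m) (compress E block_width slowness (odd m))
    (compress E block_width slowness (~~ odd m)) x.
Proof.
rewrite /block_word /run_word act_flatten_map /block_run; congr foldl.
apply/funext => y; apply/funext => t; rewrite act_flatten_nseq; apply: eq_iter => z.
rewrite act_cat act_flatten_nseq act_compress_word; congr compress.
by apply: eq_iter => u; rewrite act_compress_word.
Qed.

(** The errors of successive blocks add up, since words act by contractions. *)
Lemma act_prefix_axis c m :
  rnorm (act three_spaces (prefix_word block_word m) (E c (axis 0)) - E c (axis m))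
  <= 4^-1.
Proof.
suff: rnorm (act three_spaces (prefix_word block_word m) (E c (axis 0)) -
             E c (axis m)) <= (1 - 2^-1 ^+ m) / 4.
  move/le_trans; apply; rewrite ler_pdivrMr// mulVf// gerBl exprn_ge0//.
elim: m => [|m IH]; first by rewrite subrr rnorm0 expr0 subrr mul0r.
rewrite prefix_wordS act_cat; set u := act _ _ _ in IH *.
have transfer := block_transfer E_on E_orth block_width_gt0 slowness_gt0
  (slowness_next R) (slowness_prev R) c m.
have -> : act three_spaces (block_word m) u - E c (axis m.+1) =
    act three_spaces (block_word m) (u - E c (axis m)) +
    (act three_spaces (block_word m) (E c (axis m)) - E c (axis m.+1)).
  by rewrite actB ?subrKA//; exact: three_spaces_closed.
rewrite (le_trans (rnormD _ _))//.
have h1 := act_contraction three_spaces_closed (block_word m) (u - E c (axis m)).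
rewrite (le_trans (lerD (le_trans h1 IH) (_ : _ <= 3 / (block_width m)%:R)))//.
  by rewrite act_block_word.
rewrite /block_width natrM natrX exprS.
have -> : 3 / (24%:R * 2%:R ^+ m) = 2^-1 ^+ m / 8 :> R.
  by rewrite exprVn; field; rewrite expf_neq0.
by lra.
Qed.

Lemma three_spaces_invariant c l y :
  orthocompl [set s | exists d, s = E c d] y ->
  orthocompl [set s | exists d, s = E c d] (orthoproj (three_spaces l) y).
Proof.
have Eo c' d : c <> c' -> orthocompl [set s | exists d, s = E c d] (E c' d).
  by move=> cc' _ [d' ->]; rewrite E_orth// => /esym.
move=> Ny; rewrite /three_spaces; case: ifP => _.
  apply: orthoproj_invariant Ny; first exact: orthocompl_closed.
  move=> _ [c' [m [i ->]]]; have [<-|cc'] := pselect (c = c'); last by left; exact: Eo.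
  by right=> w; apply; exists (shadow m i).
apply: orthoproj_invariant Ny; first exact: orthocompl_closed.
move=> _ [c' [m [[_ [i ->]]|[_ [j ->]]]]].
  have [<-|cc'] := pselect (c = c').
    right=> w Nw; rewrite /kvec dotpBr !dotpZr [dotp H w (E _ _)]Nw; last by eexists.
    rewrite mulr0 subr0 dotp_sumr big1 ?mulr0// => k _.
    by rewrite dotpZr Nw ?mulr0//; eexists.
  left=> _ [d ->]; rewrite dotpC /kvec dotpBr !dotpZr dotp_sumr big1 ?mulr0//.
    by rewrite E_orth// mulr0 subrr conj0.
  by move=> k _; rewrite dotpZr E_orth// mulr0.
have [<-|cc'] := pselect (c = c'); last by left; exact: Eo.
by right=> w; apply; exists (aux m j).
Qed.

(** Let g be the coordinate of x along the axis 0 of the copy c. The words keep apart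
    the vectors orthogonal to this copy, so along the test vector g e_m the
    iterates of x behave as those of |g|^2 e_0: their inner product with it is at
    least 3|g|^2/4 after m blocks, and at most |g|^2/4 after m+1 blocks. *)
Lemma iterates_diverge c x : dotp H x (E c (axis 0)) != 0 ->
  (forall d, d != axis 0 -> dotp H x (E c d) = 0) ->
  ~ cvgn (iterates three_spaces (infinite_word ord0 block_word) x).
Proof.
move=> x0 xd; set T := fun m => act three_spaces (prefix_word block_word m).
set g := dotp H x (E c (axis 0)) in x0.
pose gam : R := re (g * scalar_conj R F g).
have gam0 : 0 < gam.
  rewrite lt_def re_mulconj_ge0 andbT; apply: contra_neq x0; exact: re_mulconj_eq0.
have dotT m d : rdot (T m x) (g *: E c d) = gam * rdot (T m (E c (axis 0))) (E c d).
  pose x' := x - g *: E c (axis 0).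
  have Nx' : orthocompl [set s | exists d, s = E c d] x'.
    move=> _ [d' ->]; rewrite /x' dotpBl dotpZl E_on.
    have [<-|d'0] := eqVneq (axis 0) d'; first by rewrite mulr1 subrr.
    by rewrite xd 1?eq_sym// mulr0 subrr.
  have -> : T m x = g *: T m (E c (axis 0)) + T m x'.
    rewrite -act_linear; last exact: three_spaces_closed.
    by rewrite /x' addrC subrK.
  rewrite rdotDl [X in _ + X]/rdot dotpZr.
  have NT := act_invariant (prefix_word block_word m) (@three_spaces_invariant c) Nx'.
  rewrite [dotp H (T m x') _]NT; last by exists d.
  rewrite mulr0 raddf0 addr0 /rdot dotpZl dotpZr mulrA -emb_re_mulconj.
  exact: re_embM.
have en m : rnorm (E c (axis m)) = 1.
  by apply/eqP; rewrite -sqrp_eq1 ?rnorm_ge0// rnorm_sqr (rdotE E_on) eqxx.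
have near m d : rdot (T m (E c (axis 0))) (E c (axis d)) =
    (m == d)%:R + rdot (T m (E c (axis 0)) - E c (axis m)) (E c (axis d)).
  by rewrite rdotBl (rdotE E_on) addrC subrK.
have small m d : `|rdot (T m (E c (axis 0)) - E c (axis m)) (E c (axis d))| <= 4^-1.
  have h := act_prefix_axis c m; set v := _ - _ in h *.
  rewrite ler_norml; have := rdot_le v (E c (axis d)).
  have := rdot_le (- v) (E c (axis d)).
  rewrite rnormN en mulr1 -[- v]add0r rdotBl rdot0l sub0r => h1 h2.
  by rewrite (le_trans h2 h) andbT lerNl (le_trans h1 h).
have subseqT m : exists2 k, (m <= k)%N &
    iterates three_spaces (infinite_word ord0 block_word) x k = T m x.
  exists (size (prefix_word block_word m)).
    exact: (size_prefix_word size_block_word).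
  exact: (iterates_infinite_word _ _ _ _ size_block_word).
clearbody T.
have sep m : Num.sqrt gam / 2 <= rnorm (T m x - T m.+1 x).
  have := rdot_le (T m x - T m.+1 x) (g *: E c (axis m)).
  have -> : rnorm (g *: E c (axis m)) = Num.sqrt gam.
    apply/eqP; rewrite -(eqrXn2 (n := 2)) ?rnorm_ge0 ?sqrtr_ge0//.
    rewrite sqr_sqrtr ?ltW// rnorm_sqr /rdot dotpZl dotpZr E_on eqxx mulr1.
    by rewrite eqxx.
  rewrite rdotBl (dotT m) (dotT m.+1) (near m) (near m.+1) eqxx (gtn_eqF (ltnSn m)) add0r.
  have /ler_normlP[s1 _] := small m m; have /ler_normlP[_ s2] := small m.+1 m.
  move: (rdot _ _) (rdot _ _) s1 s2 => b a s1 s2.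
  have r0 : 0 < Num.sqrt gam by rewrite sqrtr_gt0.
  move=> le_ab.
  rewrite -(ler_pM2r r0); apply: le_trans le_ab.
  have -> : Num.sqrt gam / 2 * Num.sqrt gam = gam / 2 by rewrite mulrAC -expr2 sqr_sqrtr// ltW.
  by rewrite -mulrBr ler_pM2l// mulr1n; lra.
move=> /cvg_ex[p /rcvgP up].
have r0 : 0 < Num.sqrt gam by rewrite sqrtr_gt0.
have [N uN] := up (Num.sqrt gam / 4) (divr_gt0 r0 (ltr0n _ 4)).
have uT m : (N <= m)%N -> rnorm (T m x - p) < Num.sqrt gam / 4.
  by move=> Nm; have [k mk <-] := subseqT m; apply: uN; exact: leq_trans mk.
have := sep N; rewrite leNgt => /negP; apply.
rewrite -(subrKA p) (le_lt_trans (rnormD _ _))//.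
have := uT N (leqnn _); have := uT N.+1 (leqnSn _).
rewrite [rnorm (p - _)]rnormB; lra.
Qed.

End Divergence.

(** * The subspaces X and Y *)

Lemma nat_pairing : exists f : nat * nat -> nat, bijective f.
Proof.
have /card_set_bijP[f bf] := card_nat2.
by exists f; rewrite -setTT_bijective.
Qed.

Section Subspaces.
Context {R : realType} {F : scalars} {H : hilbertSpace R F}.
Variables (I : Type) (V : I * nat -> nat -> H).
Hypothesis V_on : forall c a b, dotp H (V c a) (V c b) = (a == b)%:R.
Hypothesis V_orth : forall c c' a b, c <> c' -> dotp H (V c a) (V c' b) = 0.
Hypothesis V_total : forall z, (forall c a, dotp H z (V c a) = 0) -> z = 0.
Variable o : nat.

Definition head_space : set H :=
  orthocompl [set s | exists c n, n <> o /\ s = V c n].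

(** Each coordinate n of each copy c receives a copy of its own, whose head will
    repeat this coordinate. *)
Definition copied_to (c : I * nat) (n : nat) : I * nat := (c.1, pickle (c.2, n)).

Definition graph_space : set H :=
  orthocompl [set s | exists c n, n <> o /\ s = V c n - V (copied_to c n) o].

Let headC : closed_subspace head_space := orthocompl_closed _.
Let graphC : closed_subspace graph_space := orthocompl_closed _.

Lemma copied_to_inj c n c' n' : copied_to c n = copied_to c' n' -> c = c' /\ n = n'.
Proof.
by case: c c' => [i a] [i' a'] [-> /(pcan_inj pickleK)[-> ->]].
Qed.

Lemma head_space_V c : head_space (V c o).
Proof.
move=> _ [c' [n [no ->]]]; have [<-|cc'] := pselect (c = c'); last exact: V_orth.
by rewrite V_on; case: eqP => // /esym.
Qed.

Lemma graph_space_sum c n : n <> o -> graph_space (V c n + V (copied_to c n) o).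
Proof.
move=> no _ [c' [n' [no' ->]]]; rewrite dotpDl !dotpBr.
have Vo c1 c2 m : m <> o -> dotp H (V c1 m) (V c2 o) = 0.
  move=> mo; have [<-|cc] := pselect (c1 = c2); last exact: V_orth.
  by rewrite V_on; case: eqP.
rewrite (Vo c _ n no) [dotp H (V (copied_to _ _) o) (V c' n')]dotpC (Vo c' _ n' no').
rewrite conj0 subr0 sub0r.
have [[<- <-]|neq] := pselect ((c, n) = (c', n')); first by rewrite !V_on !eqxx subrr.
rewrite [dotp H (V (copied_to _ _) _) _]V_orth; last first.
  by move=> /copied_to_inj[cE nE]; apply: neq; rewrite cE nE.
rewrite subr0; have [cE|cc] := pselect (c = c'); last by rewrite V_orth.
by rewrite cE V_on; case: eqP => // nE; case: neq; rewrite cE nE.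
Qed.

(** A vector killed by the projection on the head space has no head coordinate;
    if moreover its projection w on the graph space is killed, then w = 0, hence the
    vector is orthogonal to the graph space, which copies all the other
    coordinates to heads. *)
Lemma head_or_graph z : z != 0 ->
  orthoproj head_space z != 0 \/ orthoproj head_space (orthoproj graph_space z) != 0.
Proof.
move=> z0; apply: contrapT => /not_orP[/negP/negPn/eqP hz /negP/negPn/eqP hgz].
have kill x c : orthoproj head_space x = 0 -> dotp H x (V c o) = 0.
  move=> hx; have [_ /(_ _ (head_space_V c))] := orthoprojP headC x.
  by rewrite hx subr0.
have [gw zw] := orthoprojP graphC z; set w := orthoproj graph_space z in hgz gw zw.
have w0 : w = 0.
  apply: V_total => c n; have [->|/eqP no] := eqVneq n o; first exact: kill.
  have := gw (V c n - V (copied_to c n) o) (ex_intro _ c (ex_intro _ n (conj no erefl))).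
  by rewrite dotpBr (kill w)// subr0.
move/eqP: z0; apply; apply: V_total => c n.
have [->|/eqP no] := eqVneq n o; first exact: kill.
have := zw _ (graph_space_sum c no).
by rewrite w0 subr0 dotpDr (kill z)// addr0.
Qed.

Lemma head_space_coord x : head_space x -> x != 0 -> exists c, dotp H x (V c o) != 0.
Proof.
move=> hx; apply: contra_neqP => /forallNP x0; apply: V_total => c n.
have [->|/eqP no] := eqVneq n o; first by apply/eqP/negPn/negP/x0.
by apply: hx; exists c, n.
Qed.

End Subspaces.

(** Splitting the sequence e i into sequences V (i, a) makes room, among the heads,
    for copies of all the coordinates that are not heads. *)
Lemma three_letters_diverge (R : realType) (F : scalars) (H : hilbertSpace R F) :
  infinite_dimensional H ->
  exists (X Y : set H) (Xs : 'I_3 -> set H),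
    [/\ closed_subspace X, closed_subspace Y,
        forall i, closed_subspace (Xs i)
      & forall z : H, z != 0 ->
          ~ cvgn (iterates Xs (infinite_word ord0 block_word) (orthoproj X z)) \/
          ~ cvgn (iterates Xs (infinite_word ord0 block_word)
                    (orthoproj X (orthoproj Y z)))].
Proof.
move=> /orthonormal_system[I [e [e_on e_orth e_total]]].
have [pr [rp prK rpK]] := nat_pairing.
pose V (c : I * nat) n := e c.1 (pr (c.2, n)).
have V_on c a b : dotp H (V c a) (V c b) = (a == b)%:R.
  rewrite e_on (can_eq prK); congr (nat_of_bool _)%:R.
  by rewrite xpair_eqE eqxx.
have V_orth c c' a b : c <> c' -> dotp H (V c a) (V c' b) = 0.
  move=> cc'; have [ii'|ii'] := pselect (c.1 = c'.1); last exact: e_orth.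
  rewrite /V ii' e_on (can_eq prK) xpair_eqE.
  case: eqP => // aa'; case: cc'.
  by move: ii' aa'; case: c c' => [? ?] [? ?] /= -> ->.
have V_total z : (forall c a, dotp H z (V c a) = 0) -> z = 0.
  move=> zV; apply: e_total => i a.
  by have := zV (i, (rp a).1) (rp a).2; rewrite /V /= -surjective_pairing rpK.
pose E (c : I * nat) (d : slot) := V c (pickle d).
have E_on c d d' : dotp H (E c d) (E c d') = (d == d')%:R.
  by rewrite V_on (inj_eq (pcan_inj pickleK)).
have E_orth c c' d d' : c <> c' -> dotp H (E c d) (E c' d') = 0 by exact: V_orth.
pose o := pickle (axis 0).
have diverge x : head_space V o x -> x != 0 ->
    ~ cvgn (iterates (three_spaces E) (infinite_word ord0 block_word) x).
  move=> hx x0; have [c xc] := head_space_coord V_total hx x0.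
  apply: (iterates_diverge E_on E_orth xc) => d d0; apply: hx.
  exists c, (pickle d); split => // /(pcan_inj pickleK)/eqP.
  by apply/negP.
exists (head_space V o), (graph_space V o), (three_spaces E).
have Xc : closed_subspace (head_space V o) by exact: orthocompl_closed.
split => //; [exact: orthocompl_closed|exact: three_spaces_closed|].
move=> z /(head_or_graph V_on V_orth V_total o) [|] nz; [left|right];
  by apply: diverge => //; exact: (orthoprojP Xc _).1.
Qed.

Lemma cvgn_shift (R : realType) (F : scalars) (H : hilbertSpace R F) (u : nat -> H) :
  cvgn u -> cvgn (fun n => u n.+1).
Proof.
move=> /cvg_ex[l ul]; apply/cvg_ex; exists l.
by move: ul; rewrite -cvg_shiftS.
Qed.

Theorem theorem3p3 (R : realType) :
  (forall (F : scalars) (H : hilbertSpace R F), infinite_dimensional H ->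
     exists M : 'I_5 -> set H,
       (forall i, closed_subspace (M i)) /\
       (forall z : H, z != 0 ->
          exists j : nat -> 'I_5, ~ cvgn (iterates M j z))) /\
  (exists k : nat -> 'I_3,
     forall (F : scalars) (H : hilbertSpace R F), infinite_dimensional H ->
     exists (X Y : set H) (Xs : 'I_3 -> set H),
       [/\ closed_subspace X, closed_subspace Y,
           forall i, closed_subspace (Xs i)
         & forall z : H, z != 0 ->
             ~ cvgn (iterates Xs k (orthoproj X z)) \/
             ~ cvgn (iterates Xs k (orthoproj X (orthoproj Y z)))]).
Proof.
split; last by exists (infinite_word ord0 block_word); exact: three_letters_diverge.
move=> F H /three_letters_diverge[X [Y [Xs [Xc Yc Xsc div]]]].
set k := infinite_word _ _ in div.
pose M (i : 'I_(2 + 3)) := match fintype.split i with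
  | inl a => if a == ord0 then X else Y
  | inr b => Xs b
  end.
have ML (a : 'I_2) : M (lshift 3 a) = if a == ord0 then X else Y.
  by rewrite /M; have := unsplitK (inl a : 'I_2 + 'I_3) => /= ->.
have MR (b : 'I_3) : M (rshift 2 b) = Xs b.
  by rewrite /M; have := unsplitK (inr b : 'I_2 + 'I_3) => /= ->.
exists M; split.
  by move=> i; rewrite /M; case: fintype.split => // a; case: ifP.
move=> z /div[zdiv|zdiv].
  pose j n := if n is p.+1 then rshift 2 (k p) else lshift 3 (ord0 : 'I_2).
  have jE p : iterates M j z p.+1 = iterates Xs k (orthoproj X z) p.
    elim: p => [|p IH]; first by rewrite /= ML.
    by rewrite -[LHS]/(orthoproj (M (j p.+1)) (iterates M j z p.+1)) IH MR.
  exists j; apply: contra_not zdiv; rewrite -(funext jE); exact: cvgn_shift.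
pose j n := match n with
  | 0 => lshift 3 (ord_max : 'I_2)
  | 1 => lshift 3 (ord0 : 'I_2)
  | p.+2 => rshift 2 (k p) end.
have jE p : iterates M j z p.+2 = iterates Xs k (orthoproj X (orthoproj Y z)) p.
  elim: p => [|p IH]; first by rewrite /= !ML.
  by rewrite -[LHS]/(orthoproj (M (j p.+2)) (iterates M j z p.+2)) IH MR.
exists j; apply: contra_not zdiv; rewrite -(funext jE) => /cvgn_shift.
exact: cvgn_shift.
Qed.
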